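(* Let $H$ be a finite-dimensional Hopf algebra over a field $\mathbf{k}$, $A$ a partial $H$-module algebra, $B$ a unital enveloping $H$-module algebra of $A$ (with $A$ identified with its image in $B$), and $e=1_A\# 1_H\#\epsilon\in (B\# H)\# H^*$. Let $\{h_i\}$ be a basis of $H$ with dual basis $\{h_i^*\}$ of $H^*$, and let $\Phi:(B\# H)\# H^*\to\operatorname{End}_B(B\otimes H)$ be the Blattner-Montgomery algebra isomorphism $$\Phi(b\# h\# f)=\sum_i (h_i\rhd b)\otimes\rho\big((S^* )^{-1}(h_i^* )\# 1_H\big)\,\lambda(h\# f),$$ where $B\otimes\operatorname{End}_{\mathbf{k}}(H)$ is identified with $\operatorname{End}_B(B\otimes H)$. Then $$(\underline{A\# H})\# H^*\simeq\operatorname{End}_B\big(\Phi(e)(B\otimes H)\big)$$ as $\mathbf{k}$-algebras.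
   Context: All algebras are associative $\mathbf{k}$-algebras. $S$ is the antipode of $H$ (bijective since $H$ is finite dimensional), $S^*$ its transpose, so $(S^* )^{-1}(f)=f\circ S^{-1}$; Sweedler notation is used. $H^*$ is the dual Hopf algebra (convolution product, unity $\epsilon$, coproduct dual to the multiplication of $H$). A (left) partial $H$-module algebra is a unital algebra $A$ with a linear map $H\otimes A\to A$, $h\otimes a\mapsto h\cdot a$, such that $h\cdot(ab)=\sum(h_{(1)}\cdot a)(h_{(2)}\cdot b)$, $1_H\cdot a=a$, and $h\cdot(g\cdot a)=\sum(h_{(1)}\cdot 1_A)((h_{(2)}g)\cdot a)$ for all $a,b\in A$, $g,h\in H$. An enveloping $H$-module algebra (enveloping action) of $A$ is a left $H$-module algebra $B$ (action denoted $h\rhd b$) with an algebra monomorphism $\varphi:A\to B$ (not necessarily preserving unities) such that $\varphi(A)$ is a right ideal of $B$ and $\varphi(h\cdot a)=\varphi(1_A)(h\rhd\varphi(a))$ for all $h\in H$, $a\in A$. It is called unital if $B$ is a unital algebra. Smash products: $B\# H$ is $B\otimes H$ with product $(b\# h)(c\# k)=\sum b(h_{(1)}\rhd c)\# h_{(2)}k$. The partial smash product $\underline{A\# H}$ is the linear span of the elements $\sum a(h_{(1)}\cdot 1_A)\# h_{(2)}$ ($a\in A$, $h\in H$) in $A\otimes H$, with product induced by $(a\otimes h)(b\otimes k)=\sum a(h_{(1)}\cdot b)\otimes h_{(2)}k$; it is a unital algebra with unity $1_A\# 1_H$. $H^*$ acts on $B\# H$ and on $\underline{A\# H}$ by $f\cdot(b\#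 h)=\sum b\# h_{(1)}f(h_{(2)})$, and $(B\# H)\# H^*$, $(\underline{A\# H})\# H^*$ are the corresponding smash products, with product $(x\# f)(y\# g)=\sum x(f_{(1)}\cdot y)\# f_{(2)}g$. The linear maps $\lambda:H\# H^*\to\operatorname{End}_{\mathbf{k}}(H)$ and $\rho:H^*\# H\to\operatorname{End}_{\mathbf{k}}(H)$ (with underlying spaces $H\otimes H^*$ and $H^*\otimes H$) are $\lambda(h\# f)(k)=h(f\rightharpoonup k)$ and $\rho(f\# h)(k)=(k\leftharpoonup f)h$, where $f\rightharpoonup k=\sum k_{(1)}f(k_{(2)})$ and $k\leftharpoonup f=\sum f(k_{(1)})k_{(2)}$. Products in $\operatorname{End}_{\mathbf{k}}(H)$ are compositions. $B\otimes H$ is a free right $B$-module via $(b\otimes h)c=bc\otimes h$, and $B\otimes\operatorname{End}_{\mathbf{k}}(H)$ is identified with the algebra $\operatorname{End}_B(B\otimes H)$ of right $B$-module endomorphisms via $(b\otimes T)(c\otimes k)=bc\otimes T(k)$. Thus $\Phi(e)(B\otimes H)$ is a right $B$-submodule of $B\otimes H$. *)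

(* Defs.v *)
From HB Require Import structures.
From mathcomp Require Import all_boot all_order all_algebra all_field.
From mathcomp Require Import boolp functions.

Set Implicit Arguments.
Unset Strict Implicit.
Unset Printing Implicit Defensive.

Import GRing.Theory.
Local Open Scope ring_scope.

(* Unital associative k-algebras.  Unlike algType, which requires 1 != 0, this
   includes the zero algebra. *)
HB.mixin Record isKAlgebra (k : fieldType) A of GRing.Lmodule k A := {
  aone : A;
  amul : A -> A -> A;
  amulA : associative amul;
  amul1r : left_id aone amul;
  amulr1 : right_id aone amul;
  lin_amull : forall y, linear (amul^~ y);
  lin_amulr : forall x, linear (amul x)
}.

#[short(type="kalgType")]
HB.structure Definition KAlgebra (k : fieldType) :=
  {A of isKAlgebra k A & GRing.Lmodule k A}.

Notation "\1" := aone : ring_scope.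
Notation "x ** y" := (amul x y) (at level 40, left associativity) : ring_scope.

Definition alg_isomorphic (k : fieldType) (A B : kalgType k) : Prop :=
  exists f : {linear A -> B},
    [/\ f \1 = \1, {morph f : x y / x ** y} & bijective f].

(* The tensor product of a vector space U by a finite-dimensional space V,
   in coordinates: x : tens U V stands for \sum_i x i \ot e_i with e the basis
   vbasis {:V}.  The universal property is bilin_ptens, tliftE, tens_sum. *)
Section Tensor.
Context {k : fieldType}.

Definition tens (U : lmodType k) (V : vectType k) : Type :=
  {ffun 'I_(\dim {:V}) -> U}.
HB.instance Definition _ (U : lmodType k) (V : vectType k) :=
  GRing.Lmodule.on (tens U V).
HB.instance Definition _ (U V : vectType k) := Vector.on (tens U V).

Definition ptens (U : lmodType k) (V : vectType k) (u : U) (v : V) : tens U V :=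
  [ffun i => coord (vbasis {:V}) i v *: u].

Definition tlift (U : lmodType k) (V : vectType k) (W : lmodType k)
    (F : U -> V -> W) (x : tens U V) : W :=
  \sum_i F (x i) (vbasis {:V})`_i.

Definition bilin (U V W : lmodType k) (F : U -> V -> W) : Prop :=
  (forall v, linear (F^~ v)) /\ (forall u, linear (F u)).

End Tensor.

Notation "u \ot v" := (ptens u v) (at level 40, left associativity) : ring_scope.

Section TensorTheory.
Context {k : fieldType}.
Implicit Types (U W X : lmodType k) (V : vectType k).

Definition mklin U W (f : U -> W) (lf : linear f) : {linear U -> W} :=
  HB.pack f (GRing.isLinear.Build k U W *:%R f lf).

Lemma linD U W (f : U -> W) : linear f -> {morph f : x y / x + y}.
Proof. by move=> lf x y; have := linearD (mklin lf) x y. Qed.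
Lemma linZ U W (f : U -> W) : linear f -> forall a x, f (a *: x) = a *: f x.
Proof. by move=> lf a x; have := linearZZ (mklin lf) a x. Qed.
Lemma lin_sum U W (f : U -> W) I (r : seq I) P (F : I -> U) : linear f ->
  f (\sum_(i <- r | P i) F i) = \sum_(i <- r | P i) f (F i).
Proof. by move=> lf; have := linear_sum (mklin lf) r P F. Qed.

Lemma lin_id U : linear (fun x : U => x). Proof. by []. Qed.
Lemma lin_comp U W X (g : W -> X) (f : U -> W) :
  linear g -> linear f -> linear (fun x => g (f x)).
Proof. by move=> lg lf a x y; rewrite lf lg. Qed.
Lemma lin_bsum U W I (r : seq I) P (F : I -> U -> W) :
  (forall i, linear (F i)) -> linear (fun x => \sum_(i <- r | P i) F i x).
Proof.
move=> lF a x y; rewrite scaler_sumr -big_split; apply: eq_bigr => i _ /=.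
exact: lF.
Qed.

Lemma bilin_ptens U V : bilin (@ptens k U V).
Proof.
split=> [v a x y|u a x y]; apply/ffunP=> i; rewrite !ffunE.
  by rewrite scalerDr !scalerA mulrC.
by rewrite linearP scalerDl scalerA.
Qed.
Lemma lin_otl U V X (f : X -> U) (v : V) :
  linear f -> linear (fun x => f x \ot v).
Proof. by move=> lf; apply: (@lin_comp _ _ _ (fun u => u \ot v)) => //; apply: (bilin_ptens _ _).1. Qed.
Lemma lin_otr U V X (f : X -> V) (u : U) :
  linear f -> linear (fun x => u \ot f x).
Proof. by move=> lf; apply: (@lin_comp _ _ _ (fun v => u \ot v)) => //; apply: (bilin_ptens _ _).2. Qed.

Lemma tens_sum U V (x : tens U V) : x = \sum_i x i \ot (vbasis {:V})`_i.
Proof.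
apply/ffunP=> j; rewrite sum_ffunE (bigD1 j) //= ffunE.
rewrite coord_free ?(basis_free (vbasisP _)) // eqxx scale1r big1 ?addr0 //.
move=> i ij; rewrite ffunE coord_free ?(basis_free (vbasisP _)) //.
by rewrite (negPf ij) scale0r.
Qed.

Lemma tliftE U V W (F : U -> V -> W) u v : bilin F -> tlift F (u \ot v) = F u v.
Proof.
move=> [Fl Fr]; rewrite /tlift [in RHS](coord_vbasis (memvf v)) (lin_sum _ _ _ (Fr u)).
by apply: eq_bigr => i _; rewrite ffunE (linZ (Fl _)) (linZ (Fr u)).
Qed.

Lemma lin_tlift U V W (F : U -> V -> W) :
  (forall v, linear (F^~ v)) -> linear (tlift F).
Proof.
move=> Fl a x y; rewrite /tlift scaler_sumr -big_split; apply: eq_bigr => i _.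
by rewrite !ffunE /= Fl.
Qed.
Lemma lin_tlift' U V W X (F : U -> V -> W) (f : X -> tens U V) :
  linear f -> (forall v, linear (F^~ v)) -> linear (fun x => tlift F (f x)).
Proof. by move=> lf Fl; apply: lin_comp => //; apply: lin_tlift. Qed.
Lemma lin_tliftp U V W X (F : X -> U -> V -> W) t :
  (forall u v, linear (fun x => F x u v)) -> linear (fun x => tlift (F x) t).
Proof. by move=> lF; apply: lin_bsum => i. Qed.

Lemma eq_tlift U V W (F G : U -> V -> W) t : F =2 G -> tlift F t = tlift G t.
Proof. by move=> FG; apply: eq_bigr => i _; rewrite FG. Qed.
Lemma lin_tliftC U V W X (g : W -> X) (F : U -> V -> W) t :
  linear g -> g (tlift F t) = tlift (fun u v => g (F u v)) t.
Proof. by move=> lg; apply: lin_sum. Qed.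
Lemma tlift_id U V (t : tens U V) : tlift (@ptens k U V) t = t.
Proof. by rewrite [RHS]tens_sum. Qed.
Lemma tens_ext U V W (f g : tens U V -> W) : linear f -> linear g ->
  (forall u v, f (u \ot v) = g (u \ot v)) -> f =1 g.
Proof.
move=> lf lg fg x; rewrite [x]tens_sum (lin_sum _ _ _ lf) (lin_sum _ _ _ lg).
by apply: eq_bigr => i _; apply: fg.
Qed.

End TensorTheory.

(* tlift F (comul h) is the Sweedler sum \sum F h_(1) h_(2). *)
HB.mixin Record isHopf (k : fieldType) H of Falgebra k H := {
  comul : H -> tens H H;
  counit : H -> k;
  antipode : H -> H;
  comul_lin : linear comul;
  counit_lin : linear (counit : H -> k^o);
  antipode_lin : linear antipode;
  coassoc : forall h,
    tlift (fun x y => comul x \ot y) (comul h) =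
    tlift (fun x y => tlift (fun u v => x \ot u \ot v) (comul y)) (comul h)
      :> tens (tens H H) H;
  counitl : forall h, tlift (fun x y => counit x *: y) (comul h) = h;
  counitr : forall h, tlift (fun x y => counit y *: x) (comul h) = h;
  comul1 : comul 1 = 1 \ot 1;
  comulM : forall g h,
    comul (g * h) =
    tlift (fun x y => tlift (fun u v => (x * u) \ot (y * v)) (comul h)) (comul g);
  counit1 : counit 1 = 1;
  counitM : forall g h, counit (g * h) = counit g * counit h;
  antipodel : forall h,
    tlift (fun x y => antipode x * y) (comul h) = counit h *: 1;
  antipoder : forall h,
    tlift (fun x y => x * antipode y) (comul h) = counit h *: 1
}.

#[short(type="hopfType")]
HB.structure Definition Hopf (k : fieldType) := {H of isHopf k H & Falgebra k H}.

Notation "\sw_ ( x , y <- h ) E" := (tlift (fun x y => E) (comul h))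
  (at level 41, x, y at level 0, h at level 50, E at level 41) : ring_scope.

Section LinearityRules.
Context {k : fieldType}.
Implicit Types (X U W : lmodType k).

Lemma lin_scalel X U (f : X -> k^o) (u : U) :
  linear f -> linear (fun x => (f x : k) *: u).
Proof. by move=> lf a x y; rewrite lf scalerDl scalerA. Qed.
Lemma lin_scaler X U (f : X -> U) (c : k) :
  linear f -> linear (fun x => c *: f x).
Proof. by move=> lf a x y; rewrite lf scalerDr !scalerA mulrC. Qed.
Lemma lin_mull X (H : falgType k) (f : X -> H) (y : H) :
  linear f -> linear (fun x => f x * y).
Proof. by move=> lf a x z; rewrite lf mulrDl -scalerAl. Qed.
Lemma lin_mulr X (H : falgType k) (f : X -> H) (y : H) :
  linear f -> linear (fun x => y * f x).
Proof. by move=> lf a x z; rewrite lf mulrDr -scalerAr. Qed.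
Lemma lin_kmull X (c : k^o) (f : X -> k^o) :
  linear f -> linear ((fun x => (f x : k) * c) : X -> k^o).
Proof. by move=> lf a x z; rewrite lf mulrDl -mulrA. Qed.
Lemma lin_kmulr X (c : k^o) (f : X -> k^o) :
  linear f -> linear ((fun x => (c : k) * f x) : X -> k^o).
Proof. by move=> lf a x z; rewrite lf mulrDr mulrCA. Qed.
Lemma lin_amul_l X (A : kalgType k) (f : X -> A) (y : A) :
  linear f -> linear (fun x => f x ** y).
Proof. by move=> lf; apply: (@lin_comp _ _ _ _ (fun x => x ** y)) => //; apply: lin_amull. Qed.
Lemma lin_amul_r X (A : kalgType k) (f : X -> A) (y : A) :
  linear f -> linear (fun x => y ** f x).
Proof. by move=> lf; apply: lin_comp => //; apply: lin_amulr. Qed.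
Lemma lin_hom X (V V' : vectType k) (g : 'Hom(V, V')) (f : X -> V) :
  linear f -> linear (fun x => g (f x)).
Proof. by move=> lf; apply: lin_comp => //; apply: linearP. Qed.
Lemma lin_hom_l X (V V' : vectType k) (f : X -> 'Hom(V, V')) v :
  linear f -> linear (fun x => f x v).
Proof. by move=> lf a x y; rewrite lf add_lfunE scale_lfunE. Qed.
Lemma lin_comul X (H : hopfType k) (f : X -> H) :
  linear f -> linear (fun x => comul (f x)).
Proof. by move=> lf; apply: lin_comp => //; apply: comul_lin. Qed.
Lemma lin_counit X (H : hopfType k) (f : X -> H) :
  linear f -> linear ((fun x => counit (f x)) : X -> k^o).
Proof. by move=> lf; apply: (@lin_comp _ _ _ k^o) => //; apply: counit_lin. Qed.
Lemma lin_antipode X (H : hopfType k) (f : X -> H) :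
  linear f -> linear (fun x => antipode (f x)).
Proof. by move=> lf; apply: lin_comp => //; apply: antipode_lin. Qed.

End LinearityRules.

Ltac lin_extra := fail.
Ltac lin_step := first
  [ progress intros
  | split
  | assumption
  | apply: lin_id
  | lin_extra
  | apply: lin_otl | apply: lin_otr
  | apply: lin_tliftp | apply: lin_tlift'
  | apply: lin_amul_l | apply: lin_amul_r
  | apply: lin_mull | apply: lin_mulr
  | apply: lin_scalel | apply: lin_scaler
  | apply: lin_kmull | apply: lin_kmulr
  | apply: lin_comul | apply: lin_counit | apply: lin_antipode
  | apply: lin_hom | apply: lin_hom_l ].
Ltac lin := repeat lin_step.

Section Sweedler.
Context {k : fieldType} {H : hopfType k}.

Definition trilin (X Y Z W : lmodType k) (F : X -> Y -> Z -> W) :=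
  [/\ forall y z, linear (fun x => F x y z), forall x z, linear (fun y => F x y z)
    & forall x y, linear (F x y)].

Lemma swA (W : lmodType k) (F : H -> H -> H -> W) (h : H) : trilin F ->
  \sw_(x, z <- h) \sw_(u, v <- x) F u v z =
  \sw_(x, y <- h) \sw_(u, v <- y) F x u v.
Proof.
move=> [Fx Fy Fz].
pose G := tlift (fun t z => tlift (fun x y => F x y z) t) : tens (tens H H) H -> W.
have lG : linear G by apply: lin_tlift => z; apply: lin_tlift.
have := congr1 G (coassoc h); rewrite !(lin_tliftC _ _ lG).
have bG : bilin (fun (t : tens H H) z => tlift (fun x y => F x y z) t).
  by split=> [z|t]; [apply: lin_tlift|apply: lin_bsum => i; apply: Fz].
move=> E; transitivity (\sw_(x, y <- h) G (comul x \ot y)).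
  by apply: eq_tlift => x y; rewrite /G tliftE.
rewrite E; apply: eq_tlift => x y; rewrite (lin_tliftC _ _ lG).
by apply: eq_tlift => u v; rewrite /G tliftE // tliftE.
Qed.

Lemma swM (W : lmodType k) (F : H -> H -> W) g h : bilin F ->
  \sw_(x, y <- g * h) F x y =
  \sw_(x, y <- g) \sw_(u, v <- h) F (x * u) (y * v).
Proof.
move=> bF; have lF : linear (tlift F) by apply: lin_tlift; case: bF.
rewrite comulM (lin_tliftC _ _ lF); apply: eq_tlift => x y.
by rewrite (lin_tliftC _ _ lF); apply: eq_tlift => u v; rewrite tliftE.
Qed.

Lemma sw1 (W : lmodType k) (F : H -> H -> W) : bilin F ->
  \sw_(x, y <- 1) F x y = F 1 1.
Proof. by move=> bF; rewrite comul1 tliftE. Qed.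

Lemma sw_counitl (W : lmodType k) (f : H -> W) h : linear f ->
  \sw_(x, y <- h) counit x *: f y = f h.
Proof.
move=> lf; rewrite -[in RHS](counitl h) (lin_tliftC _ _ lf).
by apply: eq_tlift => x y; rewrite (linZ lf).
Qed.
Lemma sw_counitr (W : lmodType k) (f : H -> W) h : linear f ->
  \sw_(x, y <- h) counit y *: f x = f h.
Proof.
move=> lf; rewrite -[in RHS](counitr h) (lin_tliftC _ _ lf).
by apply: eq_tlift => x y; rewrite (linZ lf).
Qed.

End Sweedler.

Section Dual.
Context {k : fieldType}.
Variable H : hopfType k.

Definition dual : Type := 'Hom(H, k^o).
HB.instance Definition _ := Vector.on dual.
Implicit Types f g : dual.

Definition dual_one : dual := linfun (counit : H -> k^o).
Definition dual_mul f g : dual :=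
  linfun ((fun h => \sw_(x, y <- h) ((f x : k) * g y : k^o)) : H -> k^o).

Lemma dual_oneE h : dual_one h = counit h.
Proof. exact: (lfunE (mklin (@counit_lin k H))). Qed.
Lemma dual_mulE f g h : dual_mul f g h = \sw_(x, y <- h) ((f x : k) * g y : k^o).
Proof.
have l : linear (fun h => \sw_(x, y <- h) ((f x : k) * g y : k^o)) by lin.
exact: (lfunE (mklin l)).
Qed.

Lemma dual_mulA : associative dual_mul.
Proof.
move=> f g l; apply/lfunP=> h; rewrite !dual_mulE.
transitivity (\sw_(x, y <- h) \sw_(u, v <- y) ((f x : k) * (g u * l v) : k^o)).
  by apply: eq_tlift => x y; rewrite dual_mulE /tlift mulr_sumr.
rewrite -(swA (F := fun x u v => (f x : k) * (g u * l v) : k^o)); last by lin.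
apply: eq_tlift => x y; rewrite dual_mulE /tlift mulr_suml.
by apply: eq_bigr => i _; rewrite mulrA.
Qed.
Lemma dual_mul1f : left_id dual_one dual_mul.
Proof.
move=> f; apply/lfunP=> h; rewrite dual_mulE.
rewrite -[RHS](sw_counitl (f := f)); last by lin.
by apply: eq_tlift => x y; rewrite dual_oneE.
Qed.
Lemma dual_mulf1 : right_id dual_one dual_mul.
Proof.
move=> f; apply/lfunP=> h; rewrite dual_mulE.
rewrite -[RHS](sw_counitr (f := f)); last by lin.
by apply: eq_tlift => x y; rewrite dual_oneE mulrC.
Qed.
Lemma lin_dual_mull g : linear (dual_mul^~ g).
Proof.
move=> a f f'; apply/lfunP=> h; rewrite add_lfunE scale_lfunE !dual_mulE.
rewrite /tlift scaler_sumr -big_split; apply: eq_bigr => i _.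
by rewrite add_lfunE scale_lfunE mulrDl -mulrA.
Qed.
Lemma lin_dual_mulr f : linear (dual_mul f).
Proof.
move=> a g g'; apply/lfunP=> h; rewrite add_lfunE scale_lfunE !dual_mulE.
rewrite /tlift scaler_sumr -big_split; apply: eq_bigr => i _.
by rewrite add_lfunE scale_lfunE mulrDr mulrCA.
Qed.
Lemma dual_mulDl : left_distributive dual_mul +%R.
Proof. by move=> f g l; apply: linD (lin_dual_mull l) _ _. Qed.
Lemma dual_mulDr : right_distributive dual_mul +%R.
Proof. by move=> f g l; apply: linD (lin_dual_mulr f) _ _. Qed.
Lemma dual_one_neq0 : dual_one != 0.
Proof.
by apply/eqP=> /lfunP/(_ 1); rewrite dual_oneE counit1 zero_lfunE => /eqP; rewrite oner_eq0.
Qed.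

HB.instance Definition _ := GRing.Zmodule_isNzRing.Build dual
  dual_mulA dual_mul1f dual_mulf1 dual_mulDl dual_mulDr dual_one_neq0.

Lemma dual_scalerAl (a : k) f g : a *: (f * g) = (a *: f) * g.
Proof. exact: esym (linZ (lin_dual_mull g) _ _). Qed.
HB.instance Definition _ := GRing.Lmodule_isLalgebra.Build k dual dual_scalerAl.
Lemma dual_scalerAr (a : k) f g : a *: (f * g) = f * (a *: g).
Proof. exact: esym (linZ (lin_dual_mulr f) _ _). Qed.
HB.instance Definition _ := GRing.Lalgebra_isAlgebra.Build k dual dual_scalerAr.
HB.instance Definition _ := Algebra_isFalgebra.Build k dual.

Definition dual_coord n (X : n.-tuple H) (i : 'I_n) : dual :=
  linfun (coord X i : H -> k^o).
Local Notation e := (vbasis {:H}).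
Local Notation d := (dual_coord e).

Lemma dual_coordE n (X : n.-tuple H) i h : dual_coord X i h = coord X i h.
Proof.
have l : linear (coord X i : H -> k^o) by apply: linearP.
exact: (lfunE (mklin l)).
Qed.
Lemma dual_sum f : f = \sum_(i < \dim {:H}) (f e`_i : k) *: d i.
Proof.
apply/lfunP=> h; rewrite sum_lfunE [in LHS](coord_vbasis (memvf h)) linear_sum.
by apply: eq_bigr => i _; rewrite linearZ scale_lfunE dual_coordE; apply: mulrC.
Qed.

Lemma dual_tens_sum (U : lmodType k) (t : tens U dual) :
  t = \sum_(i < \dim {:H}) tlift (fun u f => (f e`_i : k) *: u) t \ot d i.
Proof.
pose g (t : tens U dual) := \sum_(i < \dim {:H}) tlift (fun u (f : dual) => (f e`_i : k) *: u) t \ot d i.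
have lg : linear g by apply: lin_bsum => i; lin.
apply: (@tens_ext _ _ _ _ (fun t => t) g) => // u f.
rewrite [in LHS](dual_sum f) (lin_sum _ _ _ ((bilin_ptens _ _).2 u)).
apply: eq_bigr => i _; rewrite tliftE; last by lin.
by rewrite (linZ ((bilin_ptens _ _).2 u)) (linZ ((bilin_ptens _ _).1 _)).
Qed.

Lemma dual_tens_inj (U : lmodType k) (t t' : tens U dual) :
  (forall h, tlift (fun u f => (f h : k) *: u) t = tlift (fun u f => (f h : k) *: u) t') ->
  t = t'.
Proof.
move=> E; rewrite (dual_tens_sum t) (dual_tens_sum t').
by apply: eq_bigr => i _; rewrite E.
Qed.

Definition dual_comul f : tens dual dual :=
  \sum_(i < \dim {:H}) \sum_(j < \dim {:H}) (f (e`_i * e`_j) : k) *: (d i \ot d j).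

Definition dual_ev2 (t : tens dual dual) (h l : H) : k^o :=
  tlift (fun f g => (f h : k) * g l : k^o) t.

Lemma dual_ev2_ot f g h l : dual_ev2 (f \ot g) h l = (f h : k) * g l.
Proof. by rewrite /dual_ev2 tliftE //; lin. Qed.
Lemma lin_ev2 h l : linear (fun t => dual_ev2 t h l).
Proof. by rewrite /dual_ev2; lin. Qed.

Lemma dual_comulE f h l : dual_ev2 (dual_comul f) h l = f (h * l).
Proof.
rewrite [in RHS](coord_vbasis (memvf h)) [in RHS](coord_vbasis (memvf l)).
rewrite mulr_suml linear_sum (lin_sum _ _ _ (lin_ev2 h l)).
apply: eq_bigr => i _; rewrite mulr_sumr linear_sum (lin_sum _ _ _ (lin_ev2 h l)).
apply: eq_bigr => j _; rewrite -scalerAl -scalerAr !linearZ.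
rewrite (linZ (lin_ev2 h l)) dual_ev2_ot !dual_coordE /=.
by rewrite scalerA [coord _ i h * _]mulrC; apply: mulrC.
Qed.

Lemma dual_ev2_inj t t' : (forall h l, dual_ev2 t h l = dual_ev2 t' h l) -> t = t'.
Proof.
move=> E; apply: dual_tens_inj => l; apply/lfunP=> h.
have lh : linear (fun f : dual => f h) by lin.
rewrite !(lin_tliftC _ _ lh); move: (E h l); rewrite /dual_ev2 /tlift => E'.
rewrite (eq_bigr (fun i => (t i h : k) * (vbasis {:dual})`_i l : k^o)); last first.
  by move=> i _; rewrite scale_lfunE mulrC.
by rewrite E'; apply: eq_bigr => i _; rewrite scale_lfunE mulrC.
Qed.

Lemma dual_comul_lin : linear dual_comul.
Proof.
move=> a f g; apply: dual_ev2_inj => h l.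
by rewrite (lin_ev2 h l) !dual_comulE add_lfunE scale_lfunE.
Qed.

Lemma exchange_tlift (U U' W : lmodType k) (V V' : vectType k)
    (F : U -> V -> U' -> V' -> W) (t : tens U V) (t' : tens U' V') :
  tlift (fun a b => tlift (F a b) t') t =
  tlift (fun c d => tlift (fun a b => F a b c d) t) t'.
Proof. exact: exchange_big. Qed.

Lemma dual_swE f h l :
  tlift (fun x y : dual => (x h : k) * y l : k^o) (dual_comul f) = f (h * l).
Proof. exact: dual_comulE. Qed.

Definition dual_counit f : k := f 1.
Definition dual_antipode f : dual := (f \o linfun antipode)%VF.

Lemma dual_antipodeE f h : dual_antipode f h = f (antipode h).
Proof. by rewrite comp_lfunE (lfunE (mklin (@antipode_lin k H))). Qed.

Lemma dual_counit_lin : linear (dual_counit : dual -> k^o).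
Proof. by rewrite /dual_counit; lin. Qed.
Lemma dual_antipode_lin : linear dual_antipode.
Proof.
by move=> a f g; apply/lfunP=> h; rewrite add_lfunE scale_lfunE !dual_antipodeE add_lfunE scale_lfunE.
Qed.

Let ev3 (h l m : H) (t : tens (tens dual dual) dual) : k^o :=
  tlift (fun u (f : dual) => (f m : k) * dual_ev2 u h l : k^o) t.

Lemma lin_ev3 h l m : linear (ev3 h l m).
Proof. by apply: lin_tlift => f; apply: lin_kmulr; apply: lin_ev2. Qed.

Lemma ev3_ot h l m u f : ev3 h l m (u \ot f) = (f m : k) * dual_ev2 u h l.
Proof.
rewrite /ev3 tliftE //; split=> [g|v]; last by lin.
by apply: lin_kmulr; apply: lin_ev2.
Qed.

Lemma ev3_inj t t' : (forall h l m, ev3 h l m t = ev3 h l m t') -> t = t'.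
Proof.
move=> E; apply: dual_tens_inj => m; apply: dual_ev2_inj => h l.
rewrite !(lin_tliftC _ _ (lin_ev2 h l)); move: (E h l m); rewrite /ev3 => E'.
rewrite (eq_tlift (G := fun u (f : dual) => (f m : k) * dual_ev2 u h l : k^o)); last first.
  by move=> u f; rewrite (linZ (lin_ev2 h l)).
rewrite E'; apply: eq_tlift => u f.
by rewrite (linZ (lin_ev2 h l)).
Qed.

Lemma dual_coassoc f :
  tlift (fun x y => dual_comul x \ot y) (dual_comul f) =
  tlift (fun x y => tlift (fun u v => x \ot u \ot v) (dual_comul y)) (dual_comul f)
    :> tens (tens dual dual) dual.
Proof.
apply: ev3_inj => h l m; rewrite !(lin_tliftC _ _ (lin_ev3 h l m)).
transitivity (f (h * l * m)).
  rewrite -dual_swE; apply: eq_tlift => x y.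
  by rewrite ev3_ot dual_comulE mulrC.
rewrite -mulrA -dual_swE; apply: eq_tlift => x y.
rewrite (lin_tliftC _ _ (lin_ev3 h l m)) -dual_swE.
rewrite /tlift mulr_sumr; apply: eq_bigr => i _.
by rewrite ev3_ot dual_ev2_ot [RHS]mulrC mulrA.
Qed.

Lemma dual_counitl f : tlift (fun x y => dual_counit x *: y) (dual_comul f) = f.
Proof.
apply/lfunP=> h; have lh : linear (fun f : dual => f h) by lin.
rewrite (lin_tliftC _ _ lh) -[h in RHS]mul1r -dual_swE.
by apply: eq_tlift => x y; rewrite scale_lfunE.
Qed.
Lemma dual_counitr f : tlift (fun x y => dual_counit y *: x) (dual_comul f) = f.
Proof.
apply/lfunP=> h; have lh : linear (fun f : dual => f h) by lin.
rewrite (lin_tliftC _ _ lh) -[h in RHS]mulr1 -dual_swE.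
by apply: eq_tlift => x y; rewrite scale_lfunE mulrC.
Qed.
Lemma dual_comul1 : dual_comul 1 = 1 \ot 1.
Proof.
by apply: dual_ev2_inj => h l; rewrite dual_comulE dual_ev2_ot !dual_oneE counitM.
Qed.
Lemma dual_comulM f g :
  dual_comul (f * g) =
  tlift (fun x y => tlift (fun u v => (x * u) \ot (y * v)) (dual_comul g))
    (dual_comul f).
Proof.
apply: dual_ev2_inj => h l; rewrite dual_comulE (lin_tliftC _ _ (lin_ev2 h l)).
transitivity (\sw_(h1, h2 <- h) \sw_(l1, l2 <- l)
    ((f (h1 * l1) : k) * g (h2 * l2) : k^o)).
  by rewrite [LHS]dual_mulE (swM (F := fun x y => (f x : k) * g y : k^o)) //; lin.
transitivity (\sw_(h1, h2 <- h) \sw_(l1, l2 <- l)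
    tlift (fun x y : dual => tlift (fun u v : dual =>
      ((x h1 : k) * u h2) * ((y l1 : k) * v l2) : k^o) (dual_comul g)) (dual_comul f)).
  apply: eq_tlift => h1 h2; apply: eq_tlift => l1 l2; rewrite -!dual_swE.
  rewrite /tlift mulr_suml; apply: eq_bigr => i _; rewrite mulr_sumr.
  by apply: eq_bigr => j _; rewrite mulrACA.
transitivity (\sw_(h1, h2 <- h)
    tlift (fun x y : dual => tlift (fun u v : dual => \sw_(l1, l2 <- l)
      (((x h1 : k) * u h2) * ((y l1 : k) * v l2) : k^o)) (dual_comul g)) (dual_comul f)).
  apply: eq_tlift => h1 h2; rewrite exchange_tlift.
  by apply: eq_tlift => x y; rewrite exchange_tlift.
rewrite exchange_tlift; apply: eq_tlift => x y.
rewrite (lin_tliftC _ _ (lin_ev2 h l)) exchange_tlift; apply: eq_tlift => u v.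
rewrite dual_ev2_ot [(x * u) h]dual_mulE [(y * v) l]dual_mulE /tlift mulr_suml.
by apply: eq_bigr => i _; rewrite mulr_sumr.
Qed.
Lemma dual_counit1 : dual_counit 1 = 1.
Proof. by rewrite /dual_counit [LHS]dual_oneE counit1. Qed.
Lemma dual_counitM f g : dual_counit (f * g) = dual_counit f * dual_counit g.
Proof. by rewrite /dual_counit [LHS]dual_mulE sw1 //; lin. Qed.
Lemma dual_antipodel f :
  tlift (fun x y => dual_antipode x * y) (dual_comul f) = dual_counit f *: 1.
Proof.
apply/lfunP=> h; have lh : linear (fun f : dual => f h) by lin.
rewrite (lin_tliftC _ _ lh) scale_lfunE [(1 : dual) h]dual_oneE.
transitivity (\sw_(x, y <- h) f (antipode x * y)).
  under [RHS]eq_tlift do rewrite -dual_swE.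
  rewrite exchange_tlift; apply: eq_tlift => x y; rewrite [LHS]dual_mulE.
  by apply: eq_tlift => a b; rewrite dual_antipodeE.
have lf : linear (f : H -> k^o) by apply: linearP.
by rewrite -(lin_tliftC _ _ lf) antipodel linearZ; apply: mulrC.
Qed.
Lemma dual_antipoder f :
  tlift (fun x y => x * dual_antipode y) (dual_comul f) = dual_counit f *: 1.
Proof.
apply/lfunP=> h; have lh : linear (fun f : dual => f h) by lin.
rewrite (lin_tliftC _ _ lh) scale_lfunE [(1 : dual) h]dual_oneE.
transitivity (\sw_(x, y <- h) f (x * antipode y)).
  under [RHS]eq_tlift do rewrite -dual_swE.
  rewrite exchange_tlift; apply: eq_tlift => x y; rewrite [LHS]dual_mulE.
  by apply: eq_tlift => a b; rewrite dual_antipodeE.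
have lf : linear (f : H -> k^o) by apply: linearP.
by rewrite -(lin_tliftC _ _ lf) antipoder linearZ; apply: mulrC.
Qed.

HB.instance Definition _ := isHopf.Build k dual
  dual_comul_lin dual_counit_lin dual_antipode_lin dual_coassoc
  dual_counitl dual_counitr dual_comul1 dual_comulM dual_counit1 dual_counitM
  dual_antipodel dual_antipoder.

(* f \o S^-1: S is bijective since H is finite-dimensional, and inv_lfun is the
   inverse of a bijective linear map. *)
Definition dual_antipode_inv f : dual := (f \o (linfun antipode)^-1)%VF.

End Dual.

Record module_algebra (k : fieldType) (H : hopfType k) (A : kalgType k) :=
  ModuleAlgebra {
    mact :> H -> A -> A;
    mact_bilin : bilin mact;
    mact_amul : forall h a b, mact h (a ** b) = \sw_(x, y <- h) (mact x a ** mact y b);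
    mact_aone : forall h, mact h \1 = counit h *: \1;
    mact_1 : forall a, mact 1 a = a;
    mact_mul : forall h g a, mact h (mact g a) = mact (h * g) a
  }.

Record partial_module_algebra (k : fieldType) (H : hopfType k) (A : kalgType k) :=
  PartialModuleAlgebra {
    pact :> H -> A -> A;
    pact_bilin : bilin pact;
    pact_amul : forall h a b, pact h (a ** b) = \sw_(x, y <- h) (pact x a ** pact y b);
    pact_1 : forall a, pact 1 a = a;
    pact_mul : forall h g a,
      pact h (pact g a) = \sw_(x, y <- h) (pact x \1 ** pact (y * g) a)
  }.

Lemma mact_pact_mul (k : fieldType) (H : hopfType k) (A : kalgType k)
    (b : module_algebra H A) h g a :
  b h (b g a) = \sw_(x, y <- h) (b x \1 ** b (y * g) a).
Proof.
have [bl br] := mact_bilin b.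
rewrite mact_mul -[LHS](sw_counitl (f := fun y => b (y * g) a)); last first.
  by apply: (@lin_comp _ _ _ _ (fun h => b h a)) => //; lin.
apply: eq_tlift => x y.
by rewrite mact_aone (linZ (lin_amull _)) amul1r.
Qed.

Definition partial_of_global (k : fieldType) (H : hopfType k) (A : kalgType k)
    (b : module_algebra H A) : partial_module_algebra H A :=
  PartialModuleAlgebra (mact_bilin b) (mact_amul b) (mact_1 b) (mact_pact_mul b).

(* (a # h)(b # g) = \sum a (h_(1) . b) # h_(2) g. *)
Definition smash_mul (k : fieldType) (H : hopfType k) (A : kalgType k)
    (act : H -> A -> A) (x y : tens A H) : tens A H :=
  tlift (fun a h =>
    tlift (fun b g => \sw_(h1, h2 <- h) ((a ** act h1 b) \ot (h2 * g))) y) x.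

(* f . (a # h) = \sum a # h_(1) f(h_(2)). *)
Definition smash_dact (k : fieldType) (H : hopfType k) (A : kalgType k)
    (f : dual H) (x : tens A H) : tens A H :=
  tlift (fun a h => \sw_(h1, h2 <- h) (a \ot ((f h2 : k) *: h1))) x.

Section SmashTheory.
Context {k : fieldType} {H : hopfType k} {A : kalgType k}.
Variable p : partial_module_algebra H A.

Lemma lin_pact_l (X : lmodType k) (f : X -> H) a :
  linear f -> linear (fun x => p (f x) a).
Proof. by move=> lf; apply: (@lin_comp _ _ _ _ (fun h => p h a)) => //; apply: (pact_bilin p).1. Qed.
Lemma lin_pact_r (X : lmodType k) (f : X -> A) h :
  linear f -> linear (fun x => p h (f x)).
Proof. by move=> lf; apply: lin_comp => //; apply: (pact_bilin p).2. Qed.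

Ltac lin_extra ::= first [apply: lin_pact_l | apply: lin_pact_r].

Local Notation smul := (smash_mul p).

Lemma lin_smash_mull y : linear (smul^~ y).
Proof. rewrite /smash_mul; lin. Qed.
Lemma lin_smash_mulr x : linear (smul x).
Proof. rewrite /smash_mul; lin. Qed.

Lemma lin_smul_l (X : lmodType k) (f : X -> tens A H) y :
  linear f -> linear (fun x => smul (f x) y).
Proof. by move=> lf; apply: (@lin_comp _ _ _ _ (fun h => smul h y)) => //; apply: lin_smash_mull. Qed.
Lemma lin_smul_r (X : lmodType k) (f : X -> tens A H) y :
  linear f -> linear (fun x => smul y (f x)).
Proof. by move=> lf; apply: lin_comp => //; apply: lin_smash_mulr. Qed.

Lemma smash_mul_ot a h b g :
  smul (a \ot h) (b \ot g) = \sw_(x, y <- h) ((a ** p x b) \ot (y * g)).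
Proof. by rewrite /smash_mul tliftE ?tliftE; lin. Qed.

Lemma pact_amul_pact h b g c :
  p h (b ** p g c) = \sw_(x, y <- h) (p x b ** p (y * g) c).
Proof.
rewrite pact_amul.
transitivity (\sw_(x, y <- h) \sw_(u, v <- y) (p x b ** p u \1 ** p (v * g) c)).
  apply: eq_tlift => x y; rewrite pact_mul (lin_tliftC _ _ (lin_amulr _)).
  by apply: eq_tlift => u v; rewrite amulA.
rewrite -(swA (F := fun x u v => p x b ** p u \1 ** p (v * g) c)); last by lin.
apply: eq_tlift => x y; rewrite -(lin_tliftC _ _ (lin_amull _)).
by rewrite -pact_amul amulr1.
Qed.

Lemma smash_mulA : associative smul.
Proof.
move=> x y z.
have tri (F G : tens A H -> tens A H -> tens A H -> tens A H) :
    trilin F -> trilin G ->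
    (forall a h b g c l, F (a \ot h) (b \ot g) (c \ot l) = G (a \ot h) (b \ot g) (c \ot l)) ->
    F x y z = G x y z.
  move=> [F1 F2 F3] [G1 G2 G3] E.
  apply: (tens_ext (F1 y z) (G1 y z)) => a h.
  apply: (tens_ext (F2 _ z) (G2 _ z)) => b g.
  apply: (tens_ext (F3 _ _) (G3 _ _)) => c l; exact: E.
apply: (tri (fun x y z => smul x (smul y z)) (fun x y z => smul (smul x y) z)).
- by split=> *; [apply: lin_smash_mull|apply: lin_smul_r; apply: lin_smash_mull
                |apply: lin_smul_r; apply: lin_smash_mulr].
- by split=> *; [apply: lin_smul_l; apply: lin_smash_mull
                |apply: lin_smul_l; apply: lin_smash_mulr|apply: lin_smash_mulr].
move=> a h b g c l; rewrite !smash_mul_ot.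
rewrite (lin_tliftC _ _ (lin_smash_mull _)) (lin_tliftC _ _ (lin_smash_mulr _)).
transitivity (\sw_(g1, g2 <- g) \sw_(x, y <- h) \sw_(y1, y2 <- y)
    ((a ** p x b ** p (y1 * g1) c) \ot (y2 * g2 * l))).
  apply: eq_tlift => g1 g2; rewrite smash_mul_ot.
  rewrite -(swA (F := fun x y1 y2 => (a ** p x b ** p (y1 * g1) c) \ot (y2 * g2 * l)));
    last by lin.
  apply: eq_tlift => u v; rewrite pact_amul_pact (lin_tliftC _ _ (lin_amulr _)).
  rewrite (lin_tliftC _ _ ((bilin_ptens _ _).1 _)).
  by apply: eq_tlift => y1 y2; rewrite amulA mulrA.
rewrite exchange_tlift; apply: eq_tlift => u v; rewrite smash_mul_ot.
rewrite (swM (F := fun y1 y2 => (a ** p u b ** p y1 c) \ot (y2 * l))); last by lin.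
exact: exchange_tlift.
Qed.

Lemma smash_mul1l : left_id (\1 \ot 1) smul.
Proof.
move=> x; apply: (tens_ext (f := smul _) (g := id)) => //.
  exact: lin_smash_mulr.
move=> a h; rewrite smash_mul_ot sw1; last by lin.
by rewrite amul1r pact_1 mul1r.
Qed.

Lemma smash_mul1r_ot a h :
  smul (a \ot h) (\1 \ot 1) = \sw_(x, y <- h) ((a ** p x \1) \ot y).
Proof. by rewrite smash_mul_ot; apply: eq_tlift => x y; rewrite mulr1. Qed.

Lemma lin_smash_dact (f : dual H) : linear (smash_dact f : tens A H -> tens A H).
Proof. rewrite /smash_dact; lin. Qed.
Lemma lin_smash_dact_l (x : tens A H) : linear (fun f : dual H => smash_dact f x).
Proof. rewrite /smash_dact; lin. Qed.

Lemma smash_dact_ot (f : dual H) (a : A) h :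
  smash_dact f (a \ot h) = \sw_(h1, h2 <- h) (a \ot ((f h2 : k) *: h1)).
Proof. by rewrite /smash_dact tliftE //; lin. Qed.

Lemma smash_dact1 (x : tens A H) : smash_dact 1 x = x.
Proof.
apply: (tens_ext (f := smash_dact 1) (g := id)) => //.
  exact: lin_smash_dact.
move=> a h; rewrite smash_dact_ot -[RHS](sw_counitr (f := fun h => a \ot h)); last by lin.
by apply: eq_tlift => u v; rewrite [(1 : dual H) _]dual_oneE (linZ ((bilin_ptens _ _).2 _)).
Qed.

Lemma smash_dact_mul (f g : dual H) (x : tens A H) :
  smash_dact f (smash_dact g x) = smash_dact (f * g) x.
Proof.
apply: (tens_ext (f := fun x => smash_dact f (smash_dact g x)) (g := smash_dact (f * g))).
- by apply: lin_comp; apply: lin_smash_dact.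
- exact: lin_smash_dact.
move=> a h; rewrite !smash_dact_ot (lin_tliftC _ _ (lin_smash_dact _)).
transitivity (\sw_(x, y <- h) \sw_(u, v <- x) (a \ot (((f v : k) * g y) *: u))).
  apply: eq_tlift => u v; rewrite smash_dact_ot.
  have l : linear (fun u => \sw_(h1, h2 <- u) (a \ot ((f h2 : k) *: h1))) by lin.
  rewrite (linZ l) /tlift scaler_sumr; apply: eq_bigr => i _.
  by rewrite -(linZ ((bilin_ptens _ _).2 _)) scalerA mulrC.
rewrite (swA (F := fun u v y => a \ot (((f v : k) * g y) *: u))); last by lin.
apply: eq_tlift => x1 y; rewrite [(f * g) y]dual_mulE.
rewrite /tlift scaler_suml (lin_sum _ _ _ ((bilin_ptens _ _).2 _)).
by [].
Qed.

Lemma smash_dactM (f : dual H) (x y : tens A H) :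
  smash_dact f (smul x y) =
  \sw_(f1, f2 <- f) smul (smash_dact f1 x) (smash_dact f2 y).
Proof.
have lD := @lin_smash_dact.
apply: (tens_ext (f := fun x => smash_dact f (smul x y))
  (g := fun x => \sw_(f1, f2 <- f) smul (smash_dact f1 x) (smash_dact f2 y))).
- by apply: lin_comp; [apply: lD|apply: lin_smash_mull].
- by apply: lin_tliftp => f1 f2; apply: lin_smul_l; apply: lD.
move=> a h.
apply: (tens_ext (f := fun y => smash_dact f (smul (a \ot h) y))
  (g := fun y => \sw_(f1, f2 <- f) smul (smash_dact f1 (a \ot h)) (smash_dact f2 y))).
- by apply: lin_comp; [apply: lD|apply: lin_smash_mulr].
- by apply: lin_tliftp => f1 f2; apply: lin_smul_r; apply: lD.
move=> b g; rewrite smash_mul_ot (lin_tliftC _ _ (lD f)).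
transitivity (\sw_(x, y <- h) \sw_(u, v <- x) \sw_(g1, g2 <- g)
    ((f (y * g2) : k) *: ((a ** p u b) \ot (v * g1)))).
  rewrite (swA (F := fun u v y => \sw_(g1, g2 <- g)
    ((f (y * g2) : k) *: ((a ** p u b) \ot (v * g1))))); last by lin.
  apply: eq_tlift => u v; rewrite smash_dact_ot.
  rewrite (swM (F := fun h1 h2 => (a ** p u b) \ot ((f h2 : k) *: h1))); last by lin.
  apply: eq_tlift => y1 y2; apply: eq_tlift => g1 g2.
  by rewrite (linZ ((bilin_ptens _ _).2 _)).
symmetry.
transitivity (tlift (fun f1 f2 : dual H => \sw_(h1, h2 <- h) \sw_(g1, g2 <- g)
    (((f1 h2 : k) * f2 g2) *: smul (a \ot h1) (b \ot g1))) (comul f)).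
  apply: eq_tlift => f1 f2; rewrite !smash_dact_ot.
  rewrite (lin_tliftC _ _ (lin_smash_mull _)); apply: eq_tlift => h1 h2.
  rewrite (lin_tliftC _ _ (lin_smash_mulr _)); apply: eq_tlift => g1 g2.
  rewrite !(linZ ((bilin_ptens _ _).2 _)) (linZ (lin_smash_mull _)).
  by rewrite (linZ (lin_smash_mulr _)) scalerA.
rewrite exchange_tlift; apply: eq_tlift => h1 h2.
rewrite exchange_tlift [RHS]exchange_tlift; apply: eq_tlift => g1 g2.
rewrite -(lin_tliftC (g := fun z => (f (h2 * g2) : k) *: z)); last by lin.
rewrite -smash_mul_ot -dual_swE /tlift scaler_suml.
by [].
Qed.

Lemma smash_dact_aone (f : dual H) :
  smash_dact f (\1 \ot 1 : tens A H) = counit f *: (\1 \ot 1).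
Proof.
rewrite smash_dact_ot sw1; last by lin.
by rewrite (linZ ((bilin_ptens _ _).2 _)).
Qed.

Lemma smash_dact_bilin : bilin (@smash_dact k H A).
Proof. by split=> [x|f]; [apply: lin_smash_dact_l|apply: lin_smash_dact]. Qed.

End SmashTheory.

Section Smash.
Context {k : fieldType} {H : hopfType k} {A : kalgType k}.

Definition smash (b : module_algebra H A) : Type := tens A H.

Variable b : module_algebra H A.
HB.instance Definition _ := GRing.Lmodule.on (smash b).

Lemma smash_mul1r : right_id (\1 \ot 1) (smash_mul b).
Proof.
move=> x; apply: (tens_ext (f := smash_mul b ^~ _) (g := id)) => //.
  exact: (lin_smash_mull (partial_of_global b)).
move=> a h; rewrite (smash_mul1r_ot (partial_of_global b)) /=.
rewrite -[RHS](sw_counitl (f := fun h => a \ot h)); last by lin.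
apply: eq_tlift => u v; rewrite mact_aone (linZ (lin_amulr _)) amulr1.
by rewrite (linZ ((bilin_ptens _ _).1 _)).
Qed.

HB.instance Definition _ := isKAlgebra.Build k (smash b)
  (smash_mulA (partial_of_global b)) (smash_mul1l (partial_of_global b))
  smash_mul1r (lin_smash_mull (partial_of_global b))
  (lin_smash_mulr (partial_of_global b)).

Definition smash_dual : module_algebra (dual H) (smash b) :=
  ModuleAlgebra (A := smash b)
    smash_dact_bilin (smash_dactM (partial_of_global b)) smash_dact_aone
    smash_dact1 smash_dact_mul.

End Smash.

Section PartialSmash.
Context {k : fieldType} {H : hopfType k} {A : kalgType k}.
Variable p : partial_module_algebra H A.

(* The linear span of the elements \sum a (h_(1) . 1) # h_(2). *)
Definition psmash_pred : {pred tens A H} := fun x =>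
  `[< exists s : seq (A * H),
        x = \sum_(ah <- s) \sw_(h1, h2 <- ah.2) ((ah.1 ** p h1 \1) \ot h2) >].

Lemma psmash_predP x :
  reflect (exists y, x = smash_mul p y (\1 \ot 1)) (x \in psmash_pred).
Proof.
apply: (iffP idP) => [/asboolP[s ->]|[y ->]].
  exists (\sum_(ah <- s) ah.1 \ot ah.2).
  rewrite (lin_sum _ _ _ (lin_smash_mull p _)).
  by apply: eq_bigr => ah _; rewrite smash_mul1r_ot.
apply/asboolP; exists [seq (y i, (vbasis {:H})`_i) | i <- index_enum 'I_(\dim {:H})].
rewrite big_map [in LHS](tens_sum y) (lin_sum _ _ _ (lin_smash_mull p _)).
by apply: eq_bigr => i _; rewrite smash_mul1r_ot.
Qed.

Record psmash : Type := PSmash { psmash_val : tens A H; _ : psmash_val \in psmash_pred }.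
HB.instance Definition _ := [isSub for psmash_val].
HB.instance Definition _ := [Choice of psmash by <:].

Lemma psmash_closed : subsemimod_closed psmash_pred.
Proof.
have lm := lin_smash_mull p (\1 \ot 1).
split; first split.
- by apply/psmash_predP; exists 0; rewrite -[0 in RHS](scale0r 0) (linZ lm) scale0r.
- move=> x y /psmash_predP[x' ->] /psmash_predP[y' ->].
  by apply/psmash_predP; exists (x' + y'); rewrite (linD lm).
- move=> c x /psmash_predP[x' ->].
  by apply/psmash_predP; exists (c *: x'); rewrite (linZ lm).
Qed.
HB.instance Definition _ :=
  GRing.SubChoice_isSubLmodule.Build k (tens A H) psmash_pred psmash psmash_closed.

Lemma psmash_val_lin : linear psmash_val.
Proof. by move=> a x y; apply: (linearP (\val : {linear psmash -> tens A H})). Qed.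

Lemma psmash_mul_closed x y : x \in psmash_pred -> y \in psmash_pred ->
  smash_mul p x y \in psmash_pred.
Proof.
move=> _ /psmash_predP[y' ->]; apply/psmash_predP; exists (smash_mul p x y').
exact: smash_mulA.
Qed.
Lemma psmash_one_closed : \1 \ot 1 \in psmash_pred.
Proof. by apply/psmash_predP; exists (\1 \ot 1); rewrite smash_mul1l. Qed.

Definition psmash_one : psmash := PSmash psmash_one_closed.
Definition psmash_mul (x y : psmash) : psmash :=
  PSmash (psmash_mul_closed (valP x) (valP y)).

Lemma psmash_mulA : associative psmash_mul.
Proof. by move=> x y z; apply: val_inj; apply: smash_mulA. Qed.
Lemma psmash_mul1l : left_id psmash_one psmash_mul.
Proof. by move=> x; apply: val_inj; apply: smash_mul1l. Qed.
Lemma psmash_mul1r : right_id psmash_one psmash_mul.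
Proof.
move=> x; apply: val_inj => /=; have /psmash_predP[y ->] := valP x.
by rewrite -smash_mulA smash_mul1l.
Qed.
Lemma lin_psmash_mull y : linear (psmash_mul^~ y).
Proof. by move=> a x z; apply: val_inj; rewrite [RHS]psmash_val_lin; apply: lin_smash_mull. Qed.
Lemma lin_psmash_mulr x : linear (psmash_mul x).
Proof. by move=> a y z; apply: val_inj; rewrite [RHS]psmash_val_lin; apply: lin_smash_mulr. Qed.

HB.instance Definition _ := isKAlgebra.Build k psmash
  psmash_mulA psmash_mul1l psmash_mul1r lin_psmash_mull lin_psmash_mulr.

Lemma psmash_dact_closed (f : dual H) x :
  x \in psmash_pred -> smash_dact f x \in psmash_pred.
Proof.
move=> /psmash_predP[y ->]; apply/psmash_predP; exists (smash_dact f y).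
rewrite (smash_dactM p) -[in RHS](counitr f).
rewrite (lin_tliftC _ _ (lin_smash_dact_l y)) (lin_tliftC _ _ (lin_smash_mull p _)).
apply: eq_tlift => f1 f2; rewrite smash_dact_aone.
by rewrite (linZ (lin_smash_mulr p _)) (linZ (lin_smash_dact_l y)) (linZ (lin_smash_mull p _)).
Qed.

Definition psmash_dact (f : dual H) (x : psmash) : psmash :=
  PSmash (psmash_dact_closed f (valP x)).

Lemma psmash_dact_bilin : bilin psmash_dact.
Proof.
split=> [x a f g|f a x y]; apply: val_inj; rewrite [RHS]psmash_val_lin.
  exact: lin_smash_dact_l.
exact: lin_smash_dact.
Qed.
Lemma psmash_dactM f (x y : psmash) : psmash_dact f (x ** y) =
  tlift (fun f1 f2 => psmash_dact f1 x ** psmash_dact f2 y) (comul f).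
Proof.
by apply: val_inj; rewrite /= (smash_dactM p) -[RHS]/(psmash_val _)
  (lin_tliftC _ _ psmash_val_lin).
Qed.
Lemma psmash_dact_aone f : psmash_dact f \1 = counit f *: \1.
Proof. by apply: val_inj; rewrite [RHS](linZ psmash_val_lin); apply: smash_dact_aone. Qed.
Lemma psmash_dact1 x : psmash_dact 1 x = x.
Proof. by apply: val_inj; apply: smash_dact1. Qed.
Lemma psmash_dact_mul f g x :
  psmash_dact f (psmash_dact g x) = psmash_dact (f * g) x.
Proof. by apply: val_inj; apply: smash_dact_mul. Qed.

Definition psmash_dual : module_algebra (dual H) psmash :=
  ModuleAlgebra psmash_dact_bilin psmash_dactM psmash_dact_aone
    psmash_dact1 psmash_dact_mul.

End PartialSmash.

(* phi need not map \1 to \1. *)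
Record enveloping (k : fieldType) (H : hopfType k) (A B : kalgType k)
    (p : partial_module_algebra H A) (b : module_algebra H B)
    (phi : {linear A -> B}) : Prop := Enveloping {
  enveloping_mul : {morph phi : x y / x ** y};
  enveloping_inj : injective phi;
  enveloping_ideal : forall (a : A) (c : B), exists a' : A, phi a ** c = phi a';
  enveloping_act : forall (h : H) (a : A), phi (p h a) = phi \1 ** b h (phi a)
}.

Record rmod (k : fieldType) (B : kalgType k) := RMod {
  rmod_sort :> lmodType k;
  ract : rmod_sort -> B -> rmod_sort;
  ract_bilin : bilin ract;
  ract_1 : forall x, ract x \1 = x;
  ract_mul : forall x c d, ract (ract x c) d = ract x (c ** d)
}.

Section EndR.
Context {k : fieldType} {B : kalgType k}.
Variable M : rmod B.

Definition rendo_pred : {pred M -> M} := fun f =>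
  `[< (forall x y, f (x + y) = f x + f y) /\
      (forall x c, f (ract x c) = ract (f x) c) >].

Record rendo : Type := REndo { rendo_fun :> M -> M; _ : rendo_fun \in rendo_pred }.
HB.instance Definition _ := [isSub for rendo_fun].
HB.instance Definition _ := [Choice of rendo by <:].

Lemma rendo_closed : subsemimod_closed rendo_pred.
Proof.
have [rl rr] := ract_bilin M.
split; first split.
- by apply/asboolP; split=> [x y|x c]; rewrite ?addr0 //= -[0 in RHS](scale0r 0) (linZ (rl c)) scale0r.
- move=> f g /asboolP[fD fB] /asboolP[gD gB]; apply/asboolP; split=> [x y|x c].
    by rewrite -[LHS]/(f (x + y) + g (x + y)) fD gD addrACA.
  by rewrite -[LHS]/(f (ract x c) + g (ract x c)) fB gB -(linD (rl c)).
- move=> a f /asboolP[fD fB]; apply/asboolP; split=> [x y|x c].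
    by rewrite -[LHS]/(a *: f (x + y)) fD scalerDr.
  by rewrite -[LHS]/(a *: f (ract x c)) fB -(linZ (rl c)).
Qed.
HB.instance Definition _ :=
  GRing.SubChoice_isSubLmodule.Build k (M -> M) rendo_pred rendo rendo_closed.

Lemma rendoB (f : rendo) x c : f (ract x c) = ract (f x) c.
Proof. by have /asboolP[_] := valP f. Qed.
Lemma rendo_lin (f : rendo) : linear f.
Proof.
have /asboolP[fD fB] := valP f; move=> a x y; rewrite fD -{1}[x]ract_1.
by rewrite -(linZ ((ract_bilin M).2 _)) fB (linZ ((ract_bilin M).2 _)) ract_1.
Qed.
Lemma rendoP (f g : rendo) : f =1 g -> f = g.
Proof. by move=> fg; apply: val_inj; apply: funext. Qed.

Lemma rendo_id_subproof : idfun \in rendo_pred.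
Proof. exact/asboolP. Qed.
Lemma rendo_comp_subproof (f g : rendo) : (f \o g) \in rendo_pred.
Proof.
by apply/asboolP; split=> [x y|x c] /=; [rewrite !(linD (rendo_lin _))|rewrite !rendoB].
Qed.
Definition rendo_id : rendo := REndo rendo_id_subproof.
Definition rendo_comp (f g : rendo) : rendo := REndo (rendo_comp_subproof f g).

Lemma rendo_compA : associative rendo_comp.
Proof. by move=> f g h; apply: rendoP. Qed.
Lemma rendo_comp1l : left_id rendo_id rendo_comp.
Proof. by move=> f; apply: rendoP. Qed.
Lemma rendo_comp1r : right_id rendo_id rendo_comp.
Proof. by move=> f; apply: rendoP. Qed.
Lemma lin_rendo_compl g : linear (rendo_comp^~ g).
Proof. by move=> a f h; apply: rendoP. Qed.
Lemma lin_rendo_compr f : linear (rendo_comp f).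
Proof. by move=> a g h; apply: rendoP => x; apply: (rendo_lin f). Qed.

HB.instance Definition _ := isKAlgebra.Build k rendo
  rendo_compA rendo_comp1l rendo_comp1r lin_rendo_compl lin_rendo_compr.

End EndR.

Section Image.
Context {k : fieldType} {B : kalgType k} {M : rmod B}.
Variable T : rendo M.

Definition rimage_pred : {pred M} := fun x => `[< exists y, x = T y >].
Record rimage_sort : Type :=
  RImage { rimage_val : M; _ : rimage_val \in rimage_pred }.
HB.instance Definition _ := [isSub for rimage_val].
HB.instance Definition _ := [Choice of rimage_sort by <:].

Lemma rimage_closed : subsemimod_closed rimage_pred.
Proof.
have lT := rendo_lin T.
split; first split.
- by apply/asboolP; exists 0; rewrite -[0 in RHS](scale0r 0) (linZ lT) scale0r.
- move=> x y /asboolP[x' ->] /asboolP[y' ->].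
  by apply/asboolP; exists (x' + y'); rewrite (linD lT).
- move=> c x /asboolP[x' ->].
  by apply/asboolP; exists (c *: x'); rewrite (linZ lT).
Qed.
HB.instance Definition _ :=
  GRing.SubChoice_isSubLmodule.Build k M rimage_pred rimage_sort rimage_closed.

Lemma rimage_val_lin : linear rimage_val.
Proof. by move=> a x y; apply: (linearP (\val : {linear rimage_sort -> M})). Qed.

Lemma rimage_ract_subproof x c : x \in rimage_pred -> ract x c \in rimage_pred.
Proof. by move=> /asboolP[y ->]; apply/asboolP; exists (ract y c); rewrite rendoB. Qed.
Definition rimage_ract (x : rimage_sort) (c : B) : rimage_sort :=
  RImage (rimage_ract_subproof c (valP x)).

Lemma rimage_ract_bilin : bilin rimage_ract.
Proof.
split=> [c a x y|x a c d]; apply: val_inj; rewrite [RHS]rimage_val_lin.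
  exact: (ract_bilin M).1.
exact: (ract_bilin M).2.
Qed.
Lemma rimage_ract_1 x : rimage_ract x \1 = x.
Proof. by apply: val_inj; apply: ract_1. Qed.
Lemma rimage_ract_mul x c d : rimage_ract (rimage_ract x c) d = rimage_ract x (c ** d).
Proof. by apply: val_inj; apply: ract_mul. Qed.

(* The right B-submodule T(M) of M. *)
Definition rimage : rmod B :=
  RMod rimage_ract_bilin rimage_ract_1 rimage_ract_mul.

End Image.

Section TensorEnd.
Context {k : fieldType} {B : kalgType k} {H : vectType k}.

Definition tens_ract (x : tens B H) (c : B) : tens B H :=
  tlift (fun b h => (b ** c) \ot h) x.

Lemma tens_ract_ot b h c : tens_ract (b \ot h) c = (b ** c) \ot h.
Proof. by rewrite /tens_ract tliftE //; lin. Qed.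
Lemma tens_ract_bilin : bilin tens_ract.
Proof. by rewrite /tens_ract; lin. Qed.
Lemma tens_ract_1 x : tens_ract x \1 = x.
Proof. by rewrite /tens_ract (eq_tlift (G := @ptens k B H)) ?tlift_id // => b h; rewrite amulr1. Qed.
Lemma tens_ract_mul x c d : tens_ract (tens_ract x c) d = tens_ract x (c ** d).
Proof.
have [tl _] := tens_ract_bilin.
rewrite [X in tens_ract X _]/tens_ract (lin_tliftC _ _ (tl d)).
by apply: eq_tlift => b h; rewrite [LHS]tens_ract_ot amulA.
Qed.

(* B \ot H as a right B-module: (b \ot h) c = b c \ot h. *)
Definition tens_rmod : rmod B := RMod tens_ract_bilin tens_ract_1 tens_ract_mul.

Definition tmap (b : B) (T : 'End(H)) (x : tens B H) : tens B H :=
  tlift (fun c h => (b ** c) \ot T h) x.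

Lemma lin_tmap b T : linear (tmap b T).
Proof. by rewrite /tmap; lin. Qed.
Lemma tmap_ot b T c h : tmap b T (c \ot h) = (b ** c) \ot T h.
Proof. by rewrite /tmap tliftE //; lin. Qed.

Lemma tmap_subproof b T : tmap b T \in rendo_pred (M := tens_rmod).
Proof.
apply/asboolP; split=> [x y|x c]; first exact: linD (lin_tmap b T) x y.
apply: (tens_ext (f := fun x => tmap b T (tens_ract x c))
  (g := fun x => tens_ract (tmap b T x) c)).
- by apply: lin_comp; [apply: lin_tmap|apply: tens_ract_bilin.1].
- by apply: (@lin_comp _ _ _ _ (fun x => tens_ract x c));
    [apply: tens_ract_bilin.1|apply: lin_tmap].
by move=> d h; rewrite tens_ract_ot !tmap_ot tens_ract_ot amulA.
Qed.

(* b \ot T as an endomorphism of B \ot H: c \ot h |-> b c \ot T h. *)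
Definition tens_rendo (b : B) (T : 'End(H)) : rendo tens_rmod :=
  REndo (tmap_subproof b T).

(* The identification of B \ot End(H) with End_B(B \ot H). *)
Definition tens_end (x : tens B 'End(H)) : rendo tens_rmod := tlift tens_rendo x.

Lemma rendo_fun_lin : linear (@rendo_fun k B tens_rmod).
Proof.
by move=> a f g; apply: (linearP (\val : {linear rendo tens_rmod -> (tens_rmod -> tens_rmod)})).
Qed.
Lemma tens_rendo_bilin : bilin tens_rendo.
Proof.
split=> [T|b] a x y; apply: rendoP => z; rewrite [in RHS]rendo_fun_lin.
  have l : linear (fun b => tmap b T z) by rewrite /tmap; lin.
  exact: l.
have l : linear (fun T => tmap b T z) by rewrite /tmap; lin.
exact: l.
Qed.
Lemma tens_end_ot b T : tens_end (b \ot T) = tens_rendo b T.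
Proof. by rewrite /tens_end tliftE //; apply: tens_rendo_bilin. Qed.
Lemma tens_end_lin : linear tens_end.
Proof. by apply: lin_tlift => T; apply: tens_rendo_bilin.1. Qed.

End TensorEnd.

Section BlattnerMontgomery.
Context {k : fieldType} {H : hopfType k}.

(* f -> h = \sum h_(1) f(h_(2))  and  h <- f = \sum f(h_(1)) h_(2). *)
Definition lharp (f : dual H) (h : H) : H := \sw_(h1, h2 <- h) ((f h2 : k) *: h1).
Definition rharp (h : H) (f : dual H) : H := \sw_(h1, h2 <- h) ((f h1 : k) *: h2).

Definition bm_lambda : tens H (dual H) -> 'End(H) :=
  tlift (fun h f => linfun (fun l => h * lharp f l)).
Definition bm_rho : tens (dual H) H -> 'End(H) :=
  tlift (fun f h => linfun (fun l => rharp l f * h)).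

Lemma lharp_lin f : linear (lharp f).
Proof. by rewrite /lharp; lin. Qed.
Lemma rharp_lin f : linear (rharp^~ f).
Proof. by rewrite /rharp; lin. Qed.

Let lamE h f l : linfun (fun l => h * lharp f l) l = h * lharp f l.
Proof.
have ll : linear (fun l => h * lharp f l) by apply: lin_mulr; apply: lharp_lin.
exact: (lfunE (mklin ll)).
Qed.
Let rhoE h f l : linfun (fun l => rharp l f * h) l = rharp l f * h.
Proof.
have ll : linear (fun l => rharp l f * h) by apply: lin_mull; apply: rharp_lin.
exact: (lfunE (mklin ll)).
Qed.

Lemma bm_lambda_bilin :
  bilin (fun (h : H) (f : dual H) => linfun (fun l => h * lharp f l) : 'End(H)).
Proof.
split=> [g|g] a x y; apply/lfunP=> z; rewrite add_lfunE scale_lfunE !lamE.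
  by rewrite mulrDl -scalerAl.
have lr : linear (fun f => g * lharp f z) by rewrite /lharp; lin.
exact: lr.
Qed.
Lemma bm_rho_bilin :
  bilin (fun (f : dual H) (h : H) => linfun (fun l => rharp l f * h) : 'End(H)).
Proof.
split=> [g|g] a x y; apply/lfunP=> z; rewrite add_lfunE scale_lfunE !rhoE.
  have lr : linear (fun f => rharp z f * g) by rewrite /rharp; lin.
  exact: lr.
by rewrite mulrDr -scalerAr.
Qed.

Lemma bm_lambda_ot h f l : bm_lambda (h \ot f) l = h * lharp f l.
Proof. by rewrite /bm_lambda tliftE ?lamE //; apply: bm_lambda_bilin. Qed.
Lemma bm_rho_ot f h l : bm_rho (f \ot h) l = rharp l f * h.
Proof. by rewrite /bm_rho tliftE ?rhoE //; apply: bm_rho_bilin. Qed.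

Variables (B : kalgType k) (b : module_algebra H B).

Definition bm_Phi (X : (\dim {:H}).-tuple H) :
    smash (smash_dual b) -> rendo (@tens_rmod k B H) :=
  tlift (fun (y : smash b) f => tlift (fun c h =>
    tens_end (\sum_(i < \dim {:H}) b X`_i c \ot
      (bm_rho (dual_antipode_inv (dual_coord X i) \ot 1) \o bm_lambda (h \ot f))%VF)) y).

Lemma bm_Phi_ot (X : (\dim {:H}).-tuple H) (c d : B) (h l : H) (f : dual H) :
  bm_Phi X ((c \ot h : smash b) \ot f) (d \ot l) =
  \sum_(i < \dim {:H}) (b X`_i c ** d) \ot
    rharp (h * lharp f l) (dual_antipode_inv (dual_coord X i)).
Proof.
pose R i := bm_rho (dual_antipode_inv (dual_coord X i) \ot 1).
pose G c h f := tens_end (\sum_(i < \dim {:H}) b X`_i c \ot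
  (R i \o bm_lambda (h \ot f))%VF) : rendo (@tens_rmod k B H).
have lamlin : linear (@bm_lambda) by apply: lin_tlift => ?; apply: bm_lambda_bilin.1.
have G1 h' f' : linear (fun c => G c h' f').
  apply: lin_comp; first exact: tens_end_lin.
  apply: lin_bsum => i; apply: lin_otl; exact: (mact_bilin b).2.
have GT (Z : lmodType k) c' (g : Z -> 'End(H)) : linear g -> linear (fun z =>
    tens_end (\sum_(i < \dim {:H}) b X`_i c' \ot (R i \o g z)%VF)
    : rendo (@tens_rmod k B H)).
  move=> lg; apply: lin_comp; first exact: tens_end_lin.
  apply: lin_bsum => i; apply: lin_otr => a x y.
  by rewrite lg comp_lfunDr comp_lfunZr.
have G2 c' f' : linear (fun h => G c' h f').
  by apply: GT; apply: lin_comp => //; lin.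
have G3 c' h' : linear (fun f => G c' h' f).
  by apply: GT; apply: lin_comp => //; lin.
rewrite /bm_Phi tliftE; last first.
  by split=> *; [apply: lin_tlift => ?; apply: G1|apply: lin_tliftp => ? ?; apply: G3].
rewrite tliftE; last by split=> *; [apply: G1|apply: G2].
rewrite (lin_sum _ _ _ tens_end_lin) (lin_sum _ _ _ rendo_fun_lin).
rewrite fct_sumE.
apply: eq_bigr => i _; rewrite tens_end_ot [LHS]tmap_ot comp_lfunE.
by rewrite bm_rho_ot mulr1 bm_lambda_ot.
Qed.

End BlattnerMontgomery.

(* Main.v *)
Require Import Defs.
From mathcomp Require Import all_boot all_order all_algebra all_field.
From mathcomp Require Import boolp.

Set Implicit Arguments.
Unset Strict Implicit.
Unset Printing Implicit Defensive.

Import GRing.Theory.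
Local Open Scope ring_scope.

(* The bijection d \ot l |-> (1 # l)(d # 1) from B \ot H to B # H turns Phi into
   the natural representation x # f : w |-> x (f . w) of (B # H) # H^* on B # H,
   where B acts on the right by multiplication.  An endomorphism T commuting with
   B is determined by the values t(l) = T(1 # l), and if T comes from
   z = \sum x_i # f_i, then \sum f_i(l) x_i = \sum t(l_(2)) (1 # S^-1(l_(1)));
   this formula inverts the representation, so Phi is an algebra isomorphism.
   Hence End_B(Phi(e)(B \ot H)) is the corner e ((B # H) # H^* ) e, and since
   phi(A) = phi(1) B this corner is the image of the partial smash product under
   phi \ot id \ot id.

   The formula needs S to be bijective, which is proved along the lines of Larson
   and Sweedler: H has a nonzero left integral t, and if f \o S = 0, the identity
   \sum t_(1) \ot S(t_(2)) y = \sum y t_(1) \ot S(t_(2)) forces f(y) t = 0. *)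

Lemma tlift0 (k : fieldType) (U W : lmodType k) (V : vectType k)
    (F : U -> V -> W) t : (forall u v, F u v = 0) -> tlift F t = 0.
Proof. by move=> F0; apply: big1 => i _; apply: F0. Qed.

(** * Bijectivity of the antipode of a finite-dimensional Hopf algebra *)

Section Antipode.
Context {k : fieldType} {H : hopfType k}.
Local Notation S := (@antipode k H).
Local Notation e := (vbasis {:H}).
Local Notation d := (dual_coord e).

Lemma antipode1 : S 1 = 1.
Proof.
have := antipodel (1 : H); rewrite counit1 scale1r sw1; last by lin.
by rewrite mulr1.
Qed.

Lemma antipodeZ1 (c : k) : S (c *: 1) = c *: 1.
Proof. by rewrite (linZ (@antipode_lin k H)) antipode1. Qed.

(** Both sides are convolution inverses of the multiplication. The sum of [Q] over both threefold
    coproducts becomes the left side when S(g1) g2 and then S(h1) h2 are contracted, and the right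
    side when (g2 h2) S(g3 h3) is contracted. *)
Lemma antipodeM (g h : H) : S (g * h) = S h * S g.
Proof.
pose Q (g1 g2 g3 h1 h2 h3 : H) := S h1 * (S g1 * g2) * h2 * S (g3 * h3).
have QE g1 g2 g3 h1 h2 h3 : Q g1 g2 g3 h1 h2 h3 =
  S h1 * S g1 * (g2 * h2 * S (g3 * h3)) by rewrite /Q !mulrA.
transitivity (\sw_(g1, g' <- g) \sw_(g2, g3 <- g')
   \sw_(h1, h' <- h) \sw_(h2, h3 <- h') Q g1 g2 g3 h1 h2 h3).
  rewrite -(swA (F := fun g1 g2 g3 =>
    \sw_(h1, h' <- h) \sw_(h2, h3 <- h') Q g1 g2 g3 h1 h2 h3)); last by rewrite /Q; lin.
  rewrite -[LHS](sw_counitl (f := fun g => S (g * h))); last by lin.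
  apply: eq_tlift => g' g3.
  pose K x := \sw_(h1, h' <- h) \sw_(h2, h3 <- h') (S h1 * x * h2 * S (g3 * h3)).
  have lK : linear K by rewrite /K; lin.
  rewrite -(lin_tliftC (g := K) (fun x y => S x * y) _ lK) antipodel (linZ lK); congr (_ *: _).
  rewrite /K -(swA (F := fun h1 h2 h3 => S h1 * 1 * h2 * S (g3 * h3))); last by lin.
  rewrite -[LHS](sw_counitl (f := fun h => S (g3 * h))); last by lin.
  apply: eq_tlift => h' h3.
  rewrite -(lin_tliftC (g := fun x => x * S (g3 * h3)) (fun x y => S x * 1 * y)); last by lin.
  rewrite (eq_tlift (G := fun x y => S x * y)); last by move=> *; rewrite mulr1.
  by rewrite antipodel -scalerAl mul1r.
rewrite -[RHS](sw_counitr (f := fun g => S h * S g)); last by lin.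
apply: eq_tlift => g1 g'.
have lc : linear (fun x : H => counit g' *: x) by lin.
rewrite exchange_tlift -[S h * S g1](sw_counitr (f := fun h => S h * S g1)); last by lin.
rewrite (lin_tliftC _ _ lc).
apply: eq_tlift => h1 h'.
rewrite scalerA -counitM -[X in _ = _ *: X]mulr1 scalerAr -antipoder.
rewrite (swM (F := fun x y => x * S y)); last by lin.
have lm : linear (fun x : H => S h1 * S g1 * x) by lin.
rewrite (lin_tliftC _ _ lm); apply: eq_tlift => g2 g3.
rewrite (lin_tliftC _ _ lm); apply: eq_tlift => h2 h3.
by rewrite QE.
Qed.

(** In H tensor its dual, seen as End(H), the sum of the [e_j] tensor [d_j] is the identity;
    composing it with [T] on either side gives the same element [T]. *)
Lemma dual_basis_lfun (W : lmodType k) (N : H -> dual H -> W) (T : 'End(H)) :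
  bilin N ->
  \sum_(j < \dim {:H}) N (T e`_j) (d j) = \sum_(j < \dim {:H}) N e`_j (d j \o T)%VF.
Proof.
move=> [N1 N2].
transitivity (\sum_(j < \dim {:H}) \sum_(i < \dim {:H}) (d i (T e`_j) : k) *: N e`_i (d j)).
  apply: eq_bigr => j _; rewrite [in LHS](coord_vbasis (memvf (T e`_j))).
  rewrite (lin_sum _ _ _ (N1 _)); apply: eq_bigr => i _.
  by rewrite (linZ (N1 _)) dual_coordE.
rewrite exchange_big; apply: eq_bigr => i _.
rewrite [X in N _ X](dual_sum ((d i \o T)%VF : dual H)) (lin_sum _ _ _ (N2 _)).
by apply: eq_bigr => j _; rewrite (linZ (N2 _)) comp_lfunE.
Qed.

Lemma lmulE (h x : H) : linfun ( *%R h) x = h * x.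
Proof.
have l : linear ( *%R h) by lin.
exact: (lfunE (mklin l)).
Qed.


Definition lshift (f : dual H) (h : H) : dual H := (f \o linfun ( *%R h))%VF.

Lemma lshiftE f h x : lshift f h x = f (h * x).
Proof. by rewrite comp_lfunE lmulE. Qed.

(* The bijection x \ot f |-> \sum x_(1) \ot f(S^2(x_(2)) -) trivializes the action of
   H on the second factor of H \ot H^* = End(H).  It maps the identity of H, which is
   invariant, to the family T of integrals below, which is therefore nonzero. *)
Lemma left_integral :
  exists2 t : H, t != 0 & forall h, h * t = counit h *: t.
Proof.
pose T v := \sum_(j < \dim {:H}) \sw_(x, y <- e`_j) ((d j (S (S y) * v) : k) *: x).
have lT v h : h * T v = counit h *: T v.
  pose N c x (f : dual H) := \sw_(a, b <- x) ((f (c * S (S b) * v) : k) *: a).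
  have bN c : bilin (N c) by rewrite /N; lin.
  (* First S(h3) S^2(h2) = S(S(h2) h3) is inserted, which contracts to the counit. Then
     [dual_basis_lfun] moves left multiplication by h1 onto the dual basis, where it meets S(h2) and
     contracts to the factor [counit h]. *)
  transitivity (\sw_(h1, h2 <- h) \sum_(j < \dim {:H}) N (S h2) (h1 * e`_j) (d j)).
    rewrite /tlift exchange_big mulr_sumr; apply: eq_bigr => j _.
    rewrite -[RHS]/(\sw_(h1, h2 <- h) N (S h2) (h1 * e`_j) (d j)).
    transitivity (\sw_(h1, h3 <- h) \sw_(x, y <- e`_j) \sw_(a, b <- h1)
        ((d j (S h3 * (S (S b) * S (S y)) * v) : k) *: (a * x))); last first.
      apply: eq_tlift => h1 h3; rewrite exchange_tlift /N.
      rewrite (swM (F := fun a b => (d j (S h3 * S (S b) * v) : k) *: a)); last by lin.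
      by apply: eq_tlift => a b; apply: eq_tlift => x y; rewrite !antipodeM.
    rewrite exchange_tlift (lin_tliftC (g := fun x => h * x)); last by lin.
    apply: eq_tlift => x y.
    rewrite (swA (F := fun a b h3 =>
      (d j (S h3 * (S (S b) * S (S y)) * v) : k) *: (a * x))); last by lin.
    rewrite -[LHS](sw_counitr (f := fun h => h * ((d j (S (S y) * v) : k) *: x))); last by lin.
    apply: eq_tlift => a h'.
    have lg : linear (fun z => (d j (S z * (S (S y) * v)) : k) *: (a * x)) by lin.
    rewrite (eq_tlift (G := fun b h3 =>
      (d j (S (S b * h3) * (S (S y) * v)) : k) *: (a * x))); last first.
      by move=> b h3; rewrite antipodeM !mulrA.
    rewrite -(lin_tliftC (g := fun z => (d j (S z * (S (S y) * v)) : k) *: (a * x)) _ _ lg).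
    by rewrite antipodel (linZ lg) antipode1 mul1r -scalerAr.
  transitivity (\sw_(h1, h2 <- h) \sum_(j < \dim {:H})
      N (h1 * S h2) e`_j (d j)).
    apply: eq_tlift => h1 h2; rewrite -[RHS]/(\sum_j _).
    transitivity (\sum_(j < \dim {:H}) N (S h2) (linfun ( *%R h1) e`_j) (d j)).
      by apply: eq_bigr => j _; rewrite lmulE.
    rewrite dual_basis_lfun //; apply: eq_bigr => j _; apply: eq_tlift => a b.
    by rewrite comp_lfunE lmulE !mulrA.
  have lN : linear (fun c => \sum_(j < \dim {:H}) N c e`_j (d j)).
    by apply: lin_bsum => j; rewrite /N; lin.
  rewrite -(lin_tliftC _ _ lN) antipoder (linZ lN); congr (_ *: _).
  by apply: eq_bigr => j _; apply: eq_tlift => a b; rewrite mul1r.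
apply: contrapT => noT.
have T0 v : T v = 0.
  by apply/eqP; apply: contra_notT noT => v0; exists (T v).
(* Image of the identity of H under the trivialization; evaluating its second factor at [v] gives
   [T v]. *)
pose W := \sum_(j < \dim {:H}) \sw_(a, c <- e`_j) (a \ot lshift (d j) (S (S c))) : tens H (dual H).
have W0 : W = 0.
  apply: dual_tens_inj => v.
  have l : linear (fun w : tens H (dual H) => tlift (fun u (f : dual H) => (f v : k) *: u) w) by lin.
  rewrite [RHS](_ : _ = 0) -?[RHS](T0 v); last first.
    by rewrite -(scale0r 0) (linZ l) scale0r.
  rewrite (lin_sum _ _ _ l); apply: eq_bigr => j _.
  rewrite (lin_tliftC _ _ l); apply: eq_tlift => x y.
  by rewrite tliftE ?lshiftE //; lin.
have all0 (v : H) : v = 0.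
  (* The inverse trivialization x, g |-> x1, g(S(x2) -), evaluated at [v]. On [W] it produces
     S^2(x3) S(x2) = S(x2 S(x3)), which contracts and leaves the identity of H applied to [v]. *)
  pose N w := tlift (fun x (g : dual H) => \sw_(a, b <- x) ((g (S b * v) : k) *: a)) w.
  have lN : linear N by rewrite /N; lin.
  have <- : N W = 0 by rewrite W0 -(scale0r 0) (linZ lN) scale0r.
  rewrite (lin_sum _ _ _ lN) [LHS](coord_vbasis (memvf v)); apply: eq_bigr => j _.
  rewrite (lin_tliftC _ _ lN).
  transitivity (\sw_(x, c <- e`_j) \sw_(a, b <- x) ((d j (S (S c) * (S b * v)) : k) *: a)); last first.
    apply: eq_tlift => x c; rewrite /N tliftE; last by lin.
    by apply: eq_tlift => a b; rewrite lshiftE.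
  rewrite (swA (F := fun a b c => (d j (S (S c) * (S b * v)) : k) *: a)); last by lin.
  rewrite -dual_coordE.
  rewrite -[LHS](sw_counitr (f := fun x => (d j v : k) *: x)); last by lin.
  apply: eq_tlift => a c.
  have lg : linear (fun z => (d j (S z * v) : k) *: a) by lin.
  rewrite (eq_tlift (G := fun b c => (d j (S (b * S c) * v) : k) *: a)); last first.
    by move=> x y; rewrite antipodeM mulrA.
  by rewrite -(lin_tliftC _ _ lg) antipoder (linZ lg) antipode1 mul1r.
by have /eqP := all0 1; rewrite oner_eq0.
Qed.

Lemma antipode_epi (f : dual H) : (forall x, f (S x) = 0) -> f = 0.
Proof.
move=> fS; have [t t0 ht] := left_integral.
(* The counit of y1 is absorbed into the integral as y1 t. Expanding its coproduct and contracting
   S(y2) y3 turns the sum into that of f(S(t2)) y t1, which vanishes by hypothesis. *)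
have tS y : \sw_(a, b <- t) ((f (S b * y) : k) *: a) = 0.
  transitivity (\sw_(y1, y' <- y) \sw_(y2, y3 <- y') \sw_(a, b <- t)
      ((f (S b * (S y2 * y3)) : k) *: (y1 * a))).
    rewrite -(swA (F := fun y1 y2 y3 => \sw_(a, b <- t)
      ((f (S b * (S y2 * y3)) : k) *: (y1 * a)))); last by lin.
    rewrite -[LHS](sw_counitl (f := fun y => \sw_(a, b <- t) ((f (S b * y) : k) *: a)));
      last by lin.
    apply: eq_tlift => y' y3.
    have lt : linear (fun t => \sw_(a, b <- t) ((f (S b * y3) : k) *: a)) by lin.
    rewrite -(linZ lt) -ht (swM (F := fun a b => (f (S b * y3) : k) *: a)); last by lin.
    apply: eq_tlift => y1 y2; apply: eq_tlift => a b.
    by rewrite antipodeM mulrA.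
  apply: tlift0 => y1 y'.
  have lg : linear (fun z => \sw_(a, b <- t) ((f (S b * z) : k) *: (y1 * a))) by lin.
  rewrite -(lin_tliftC _ _ lg) antipodel (linZ lg) tlift0 ?scaler0 // => a b.
  by rewrite mulr1 fS scale0r.
pose W := \sw_(a, c <- t) (a \ot lshift f (S c)) : tens H (dual H).
have W0 : W = 0.
  apply: dual_tens_inj => v.
  have l : linear (fun w : tens H (dual H) => tlift (fun u (f : dual H) => (f v : k) *: u) w) by lin.
  rewrite -[in RHS](scale0r 0) (linZ l) scale0r -[RHS](tS v) (lin_tliftC _ _ l).
  by apply: eq_tlift => x y; rewrite tliftE ?lshiftE //; lin.
apply/lfunP => y; rewrite zero_lfunE; apply/eqP.
suff: (f y : k) *: t = 0 by move/eqP; rewrite scaler_eq0 (negPf t0) orbF.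
(* Undoes the passage from t tensor [f] to [W]: S(t3) S^2(t2) = S(S(t2) t3) contracts, so that [N W]
   is f(y) t. *)
pose N w := tlift (fun x (g : dual H) => \sw_(a, b <- x) ((g (S (S b) * y) : k) *: a)) w.
have lN : linear N by rewrite /N; lin.
have <- : N W = 0 by rewrite W0 -(scale0r 0) (linZ lN) scale0r.
rewrite (lin_tliftC _ _ lN).
transitivity (\sw_(x, c <- t) \sw_(a, b <- x) ((f (S c * (S (S b) * y)) : k) *: a)); last first.
  apply: eq_tlift => x c; rewrite /N tliftE; last by lin.
  by apply: eq_tlift => a b; rewrite lshiftE.
rewrite (swA (F := fun a b c => (f (S c * (S (S b) * y)) : k) *: a)); last by lin.
rewrite -[LHS](sw_counitr (f := fun x => (f y : k) *: x)); last by lin.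
apply: eq_tlift => a c.
have lg : linear (fun z => (f (S z * y) : k) *: a) by lin.
rewrite (eq_tlift (G := fun b c => (f (S (S b * c) * y) : k) *: a)); last first.
  by move=> u v; rewrite antipodeM mulrA.
by rewrite -(lin_tliftC _ _ lg) antipodel (linZ lg) antipode1 mul1r.
Qed.

Local Notation Sh := (linfun S : 'End(H)).
(** The operation [^-1] on linear maps is total; it is known to invert [S] only once [limg_antipode]
    is available. The same map enters [dual_antipode_inv]. *)
Definition antipode_inv (h : H) : H := (Sh^-1)%VF h.

Lemma antipode_lfunE h : Sh h = S h.
Proof. exact: (lfunE (mklin (@antipode_lin k H))). Qed.

Lemma limg_antipode : limg Sh = fullv.
Proof.
apply/eqP; rewrite eqEsubv subvf; apply/subvP => v _.
(* The coordinates of the complementary projection are functionals that vanish on the image of [S],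
   hence are zero by [antipode_epi]. *)
have P0 x : x - projv (limg Sh) x = 0.
  rewrite [LHS](coord_vbasis (memvf _)) big1 // => i _.
  pose f : dual H := (d i \o (\1%VF - projv (limg Sh))%R)%VF.
  have fE y : f y = d i (y - projv (limg Sh) y).
    by rewrite comp_lfunE add_lfunE opp_lfunE id_lfunE.
  rewrite -dual_coordE -fE (_ : f = 0) ?zero_lfunE ?scale0r //.
  apply: antipode_epi => y; rewrite fE projv_id ?subrr ?linear0 //.
  by rewrite -antipode_lfunE memv_img ?memvf.
by rewrite (subr0_eq (P0 v)) memv_proj.
Qed.

Lemma antipode_inj : injective S.
Proof.
have K0 : lker Sh == 0%VS.
  have := limg_ker_dim Sh fullv; rewrite limg_antipode capfv => /eqP.
  by rewrite -[X in _ == X]add0n eqn_add2r dimv_eq0.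
by move=> x y; rewrite -!antipode_lfunE; apply: (lker0P K0).
Qed.

Lemma antipode_invK : cancel antipode_inv S.
Proof.
move=> h; rewrite -antipode_lfunE /antipode_inv limg_lfunVK //.
by rewrite limg_antipode memvf.
Qed.

Lemma antipode_inv_lin : linear antipode_inv.
Proof. by rewrite /antipode_inv; lin. Qed.

(** Applying the injective map [S], which reverses products, reduces this identity and the next one
    to the antipode axioms. *)
Lemma antipode_invr h : \sw_(x, y <- h) (y * antipode_inv x) = counit h *: 1.
Proof.
apply: antipode_inj; rewrite (lin_tliftC _ _ (@antipode_lin k H)) antipodeZ1 -antipoder.
by apply: eq_tlift => x y; rewrite antipodeM antipode_invK.
Qed.

Lemma antipode_invl h : \sw_(x, y <- h) (antipode_inv y * x) = counit h *: 1.
Proof.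
apply: antipode_inj; rewrite (lin_tliftC _ _ (@antipode_lin k H)) antipodeZ1 -antipodel.
by apply: eq_tlift => x y; rewrite antipodeM antipode_invK.
Qed.

Lemma dual_antipode_invE (f : dual H) h : dual_antipode_inv f h = f (antipode_inv h).
Proof. by rewrite comp_lfunE. Qed.

End Antipode.

Section ActionLinearity.
Context {k : fieldType} {H : hopfType k} {A : kalgType k}.
Variable b : module_algebra H A.
Implicit Types X : lmodType k.

Lemma lin_mact_l X (f : X -> H) a : linear f -> linear (fun x => b (f x) a).
Proof. by move=> lf; apply: (@lin_comp _ _ _ _ (fun h => b h a)) => //; apply: (mact_bilin b).1. Qed.
Lemma lin_mact_r X (f : X -> A) h : linear f -> linear (fun x => b h (f x)).
Proof. by move=> lf; apply: lin_comp => //; apply: (mact_bilin b).2. Qed.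
Lemma lin_antipode_inv X (f : X -> H) :
  linear f -> linear (fun x => antipode_inv (f x)).
Proof. by move=> lf; apply: lin_comp => //; apply: antipode_inv_lin. Qed.

End ActionLinearity.

Ltac lin_extra ::=
  first [apply: lin_mact_l | apply: lin_mact_r | apply: lin_antipode_inv].

(** * The natural representation of a smash product on its coefficient algebra *)

Section SmashRep.
Context {k : fieldType} {H : hopfType k} {A : kalgType k}.
Variable b : module_algebra H A.

Lemma smash_otM (a c : A) (h g : H) :
  (a \ot h : smash b) ** (c \ot g) = \sw_(x, y <- h) ((a ** b x c) \ot (y * g)).
Proof. exact: (smash_mul_ot (partial_of_global b)). Qed.

Lemma smash_otM1 (a : A) (h g : H) :
  (a \ot h : smash b) ** (\1 \ot g) = a \ot (h * g).
Proof.
rewrite smash_otM -[RHS](sw_counitl (f := fun h => a \ot (h * g))); last by lin.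
apply: eq_tlift => x y; rewrite mact_aone (linZ (lin_amulr _)) amulr1.
by rewrite (linZ ((bilin_ptens _ _).1 _)).
Qed.

Lemma smash_ot1M (a c : A) (g : H) :
  (a \ot 1 : smash b) ** (c \ot g) = (a ** c) \ot g.
Proof. by rewrite smash_otM sw1 ?mact_1 ?mul1r //; lin. Qed.

Definition smash_rep (z : smash b) (w : A) : A := tlift (fun a h => a ** b h w) z.

Lemma smash_rep_bilin : bilin smash_rep.
Proof. by rewrite /smash_rep; lin. Qed.
Lemma smash_rep_ot a h w : smash_rep (a \ot h) w = a ** b h w.
Proof. by rewrite /smash_rep tliftE //; lin. Qed.
Lemma smash_repM z z' w : smash_rep (z ** z') w = smash_rep z (smash_rep z' w).
Proof.
have [rl rr] := smash_rep_bilin.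
apply: (tens_ext (f := fun z : smash b => smash_rep (z ** z') w)
  (g := fun z => smash_rep z (smash_rep z' w))).
- exact: lin_comp (rl w) (@lin_amull _ (smash b) z').
- exact: rl.
move=> a h.
apply: (tens_ext (f := fun z' : smash b => smash_rep ((a \ot h : smash b) ** z') w)
  (g := fun z' => smash_rep (a \ot h) (smash_rep z' w))).
- exact: lin_comp (rl w) (@lin_amulr _ (smash b) (a \ot h)).
- by apply: (lin_comp (rr _)); apply: rl.
move=> c g; rewrite smash_otM (lin_tliftC _ _ (rl w)) !smash_rep_ot mact_amul.
rewrite (lin_tliftC _ _ (lin_amulr _)); apply: eq_tlift => x y.
by rewrite smash_rep_ot mact_mul amulA.
Qed.

End SmashRep.

(** * The right-linear bijection between B tensor H and B # H *)

Section Twist.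
Context {k : fieldType} {H : hopfType k} {B : kalgType k}.
Variable b : module_algebra H B.
Local Notation BH := (tens B H).
Local Notation Bs := (smash b).

Definition twist (x : BH) : Bs := tlift (fun d l => \sw_(l1, l2 <- l) (b l1 d \ot l2)) x.
Definition untwist (w : Bs) : BH :=
  tlift (fun c m => \sw_(m1, m2 <- m) (b (antipode_inv m1) c \ot m2)) w.

Lemma twist_lin : linear twist.
Proof. by rewrite /twist; lin. Qed.
Lemma untwist_lin : linear untwist.
Proof. by rewrite /untwist; lin. Qed.
Lemma twist_ot d l : twist (d \ot l) = \sw_(l1, l2 <- l) (b l1 d \ot l2).
Proof. by rewrite /twist tliftE //; lin. Qed.
Lemma untwist_ot c m :
  untwist (c \ot m) = \sw_(m1, m2 <- m) (b (antipode_inv m1) c \ot m2).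
Proof. by rewrite /untwist tliftE //; lin. Qed.

Lemma twist_otM d l : twist (d \ot l) = (\1 \ot l : Bs) ** (d \ot 1).
Proof.
by rewrite twist_ot smash_otM; apply: eq_tlift => x y; rewrite amul1r mulr1.
Qed.

Lemma twist1 l : twist (\1 \ot l) = \1 \ot l.
Proof. by rewrite twist_otM smash_otM1 mulr1. Qed.

(** The composite lets S^-1(l2) l1 act on [d]; in this order of the legs it is the inverse antipode
    that contracts. *)
Lemma twistK : cancel twist untwist.
Proof.
apply: (tens_ext (f := fun x => untwist (twist x)) (g := id)) => //.
  exact: lin_comp untwist_lin twist_lin.
move=> d l; rewrite twist_ot (lin_tliftC _ _ untwist_lin).
transitivity (\sw_(l1, l' <- l) \sw_(l2, l3 <- l') (b (antipode_inv l2 * l1) d \ot l3)).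
  apply: eq_tlift => l1 l2; rewrite untwist_ot.
  by apply: eq_tlift => x y; rewrite mact_mul.
rewrite -(swA (F := fun l1 l2 l3 => b (antipode_inv l2 * l1) d \ot l3)); last by lin.
rewrite -[RHS](sw_counitl (f := fun l => d \ot l)); last by lin.
apply: eq_tlift => x y.
have lg : linear (fun z => b z d \ot y) by lin.
by rewrite -(lin_tliftC _ _ lg) antipode_invl (linZ lg) mact_1.
Qed.

Lemma untwistK : cancel untwist twist.
Proof.
apply: (tens_ext (f := fun x => twist (untwist x)) (g := id)) => //.
  exact: lin_comp twist_lin untwist_lin.
move=> d l; rewrite untwist_ot (lin_tliftC _ _ twist_lin).
transitivity (\sw_(l1, l' <- l) \sw_(l2, l3 <- l') (b (l2 * antipode_inv l1) d \ot l3)).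
  apply: eq_tlift => l1 l2; rewrite twist_ot.
  by apply: eq_tlift => x y; rewrite mact_mul.
rewrite -(swA (F := fun l1 l2 l3 => b (l2 * antipode_inv l1) d \ot l3)); last by lin.
rewrite -[RHS](sw_counitl (f := fun l => d \ot l)); last by lin.
apply: eq_tlift => x y.
have lg : linear (fun z => b z d \ot y) by lin.
by rewrite -(lin_tliftC _ _ lg) antipode_invr (linZ lg) mact_1.
Qed.

Lemma twist_ract x c : twist (tens_ract x c) = twist x ** (c \ot 1 : Bs).
Proof.
apply: (tens_ext (f := fun x => twist (tens_ract x c))
  (g := fun x => twist x ** (c \ot 1 : Bs))).
- by apply: (lin_comp twist_lin); apply: tens_ract_bilin.1.
- by apply: lin_amul_l; apply: twist_lin.
by move=> d l; rewrite tens_ract_ot !twist_otM -amulA smash_ot1M.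
Qed.

Lemma untwist_ract w c : untwist (w ** (c \ot 1 : Bs)) = tens_ract (untwist w) c.
Proof. by rewrite -{1}(untwistK w) -twist_ract twistK. Qed.

Lemma smash_dual_ot1 (f : dual H) c : smash_dual b f (c \ot 1) = counit f *: (c \ot 1).
Proof.
rewrite [LHS]smash_dact_ot sw1; last by lin.
by rewrite (linZ ((bilin_ptens _ _).2 _)).
Qed.

Lemma smash_dual_1ot (f : dual H) l : smash_dual b f (\1 \ot l) = \1 \ot lharp f l.
Proof. by rewrite [LHS]smash_dact_ot -(lin_tliftC (g := fun z => \1 \ot z)) //; lin. Qed.

(** The dual acts on B # 1 through its counit, so its action on B # H is right B-linear. *)
Lemma smash_dual_mul1 (f : dual H) (w : Bs) c :
  smash_dual b f (w ** (c \ot 1)) = smash_dual b f w ** (c \ot 1 : Bs).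
Proof.
rewrite mact_amul -[RHS](sw_counitr (f := fun f => smash_dual b f w ** (c \ot 1 : Bs)));
  last by lin.
by apply: eq_tlift => f1 f2; rewrite smash_dual_ot1 (linZ (lin_amulr _)).
Qed.

End Twist.

Section HarpoonInverse.
Context {k : fieldType} {H : hopfType k}.

(** Separates [f] from its action on H: in f(l3) l2 S^-1(l1) the last two factors contract. This is
    what makes the representation invertible. *)
Lemma lharp_antipode_inv (f : dual H) (l : H) :
  \sw_(l1, l2 <- l) (lharp f l2 * antipode_inv l1) = (f l : k) *: 1.
Proof.
transitivity (\sw_(l1, l' <- l) \sw_(l2, l3 <- l') ((f l3 : k) *: (l2 * antipode_inv l1))).
  apply: eq_tlift => l1 l2; rewrite /lharp.
  rewrite (lin_tliftC (g := fun z => z * antipode_inv l1)); last by lin.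
  by apply: eq_tlift => x y; rewrite -scalerAl.
rewrite -(swA (F := fun l1 l2 l3 => (f l3 : k) *: (l2 * antipode_inv l1))); last by lin.
rewrite -[RHS](sw_counitl (f := fun l => (f l : k) *: 1)); last by lin.
apply: eq_tlift => x y.
have lg : linear (fun z : H => (f y : k) *: z) by lin.
by rewrite -(lin_tliftC _ _ lg) antipode_invr (linZ lg).
Qed.

End HarpoonInverse.

(** * The map Phi is an algebra isomorphism *)

Section BMIso.
Context {k : fieldType} {H : hopfType k} {B : kalgType k}.
Variable b : module_algebra H B.
Variable X : (\dim {:H}).-tuple H.
Hypothesis hX : basis_of {:H} X.
Local Notation Bs := (smash b).
Local Notation Phi := (@bm_Phi k H B b X).
Local Notation rep := (@smash_rep _ _ _ (smash_dual b)).
Local Notation e := (vbasis {:H}).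
Local Notation d := (dual_coord e).

Lemma bm_Phi_lin : linear Phi.
Proof.
apply: lin_tlift => f; apply: lin_tlift => h.
apply: lin_comp; first exact: tens_end_lin.
by apply: lin_bsum => i; lin.
Qed.

Lemma bm_PhiE z x : Phi z x = untwist (rep z (twist b x)).
Proof.
have [rl rr] := smash_rep_bilin (smash_dual b).
have lu := @untwist_lin k H B b; have lt := @twist_lin k H B b.
apply: (tens_ext (f := fun z => Phi z x) (g := fun z => untwist (rep z (twist b x)))).
- apply: (@lin_comp _ _ _ _ (fun T => rendo_fun T x)); last exact: bm_Phi_lin.
  by move=> a S T; rewrite rendo_fun_lin.
- exact: lin_comp lu (rl _).
move=> y f.
apply: (tens_ext (f := fun y => Phi (y \ot f) x)
  (g := fun y => untwist (rep (y \ot f) (twist b x)))).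
- apply: (@lin_comp _ _ _ _ (fun T => rendo_fun T x)).
    by move=> a S T; rewrite rendo_fun_lin.
  exact: lin_comp bm_Phi_lin ((bilin_ptens _ _).1 f).
- exact: lin_comp lu (lin_comp (rl _) ((bilin_ptens _ _).1 f)).
move=> c h.
apply: (tens_ext (f := Phi (c \ot h \ot f))
  (g := fun x => untwist (rep (c \ot h \ot f) (twist b x)))).
- exact: (@rendo_lin _ _ (@tens_rmod k B H) (Phi (c \ot h \ot f))).
- exact: lin_comp lu (lin_comp (rr _) lt).
move=> a l; rewrite bm_Phi_ot smash_rep_ot twist_otM smash_dual_mul1 smash_dual_1ot.
rewrite amulA smash_otM1 untwist_ract untwist_ot.
set m := h * _.
have lr : linear (fun x : tens B H => tens_ract x a) := tens_ract_bilin.1 a.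
rewrite (lin_tliftC _ _ lr).
(* The scalars h_i^*(S^-1(m1)) are the coordinates of S^-1(m1) in the basis [X], so the sum over i
   reassembles the action of S^-1(m1) on [c]. *)
transitivity (\sw_(m1, m2 <- m) \sum_(i < \dim {:H})
   ((b X`_i c ** a) \ot ((coord X i (antipode_inv m1) : k) *: m2))).
  rewrite [RHS]exchange_big; apply: eq_bigr => i _.
  rewrite -[RHS]/(\sw_(m1, m2 <- m)
   ((b X`_i c ** a) \ot ((coord X i (antipode_inv m1) : k) *: m2))).
  rewrite /rharp (lin_tliftC _ _ ((bilin_ptens _ _).2 _)); apply: eq_tlift => u v.
  by rewrite dual_antipode_invE dual_coordE.
apply: eq_tlift => m1 m2; rewrite tens_ract_ot.
have lg : linear (fun z => (b z c ** a) \ot m2) by lin.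
rewrite [in RHS](coord_basis hX (memvf (antipode_inv m1))) (lin_sum _ _ _ lg).
apply: eq_bigr => i _.
by rewrite (linZ lg) (linZ ((bilin_ptens _ _).2 _)).
Qed.

Lemma bm_PhiM : {morph Phi : z z' / z ** z'}.
Proof.
move=> z z'; apply: rendoP => x.
by rewrite -[RHS]/(Phi z (Phi z' x)) !bm_PhiE untwistK smash_repM.
Qed.

(** The right side contracts [z] with [l] and these contractions determine [z]; hence the action on
    the elements 1 # l already determines [z]. On y # f the formula is [lharp_antipode_inv]
    multiplied by [y]. *)
Lemma smash_rep_recover z l :
  \sw_(l1, l2 <- l) (rep z (\1 \ot l2) ** (\1 \ot antipode_inv l1 : Bs)) =
  tlift (fun (y : Bs) (f : dual H) => (f l : k) *: y) z.
Proof.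
have [rl rr] := smash_rep_bilin (smash_dual b).
apply: (tens_ext (f := fun z => \sw_(l1, l2 <- l)
    (rep z (\1 \ot l2) ** (\1 \ot antipode_inv l1 : Bs)))
  (g := tlift (fun (y : Bs) (f : dual H) => (f l : k) *: y))).
- apply: lin_tliftp => l1 l2; apply: lin_amul_l; exact: rl.
- by apply: lin_tlift => f; lin.
move=> y f; rewrite tliftE; last by lin.
transitivity (y ** ((\1 \ot \sw_(l1, l2 <- l) (lharp f l2 * antipode_inv l1)) : Bs)).
  have lg : linear (fun z : H => y ** (\1 \ot z : Bs)) by lin.
  rewrite (lin_tliftC _ _ lg); apply: eq_tlift => l1 l2.
  by rewrite smash_rep_ot smash_dual_1ot -amulA smash_otM1.
rewrite lharp_antipode_inv (linZ ((bilin_ptens _ _).2 _)) (linZ (lin_amulr _)).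
by rewrite -[X in y ** X]/(\1 : Bs) amulr1.
Qed.

Lemma bm_Phi_inj : injective Phi.
Proof.
move=> z z' E; apply: dual_tens_inj => l; rewrite -!smash_rep_recover.
apply: eq_tlift => l1 l2; congr (_ ** _).
rewrite -(twist1 b l2) -[LHS](untwistK (b := b)) -[RHS](untwistK (b := b)).
by rewrite -!bm_PhiE E.
Qed.

Lemma bm_Phi_surj (T : rendo (@tens_rmod k B H)) : exists z, Phi z = T.
Proof.
have lt := @twist_lin k H B b.
pose t l := twist b (T (\1 \ot l)).
have tlin : linear t.
  by apply: (lin_comp lt); apply: (lin_comp (rendo_lin T)); lin.
(* By [smash_rep_recover], the contraction with [v] that any preimage of [T] must have. *)
pose G v := \sw_(v1, v2 <- v) (t v2 ** (\1 \ot antipode_inv v1 : Bs)).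
have lG : linear G.
  apply: lin_tlift' => // v; first by lin.
  by lin.
exists (\sum_(j < \dim {:H}) G e`_j \ot d j).
(* The elements 1 tensor l generate B tensor H as a right B-module, so agreement on them is enough.
   The value at l is the sum of t(l3) (1 # S^-1(l2) l1), which contracts to t(l). *)
have E l : Phi (\sum_(j < \dim {:H}) G e`_j \ot d j) (\1 \ot l) = T (\1 \ot l).
  rewrite bm_PhiE twist1 -[RHS](twistK b); congr untwist.
  have [rl rr] := smash_rep_bilin (smash_dual b).
  rewrite (lin_sum _ _ _ (rl _)) -/(t l).
  transitivity (\sw_(a, c <- l) \sum_(j < \dim {:H}) ((d j c : k) *: (G e`_j ** (\1 \ot a : Bs)))).
    rewrite [RHS]exchange_big; apply: eq_bigr => j _.
    rewrite -[RHS]/(\sw_(a, c <- l) ((d j c : k) *: (G e`_j ** (\1 \ot a : Bs)))).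
    have lg : linear (fun z : H => G e`_j ** (\1 \ot z : Bs)) by lin.
    rewrite smash_rep_ot smash_dual_1ot /lharp (lin_tliftC _ _ lg).
    by apply: eq_tlift => x y; rewrite (linZ lg).
  transitivity (\sw_(a, c <- l) \sw_(c1, c2 <- c)
      (t c2 ** (\1 \ot (antipode_inv c1 * a) : Bs))).
    apply: eq_tlift => a c.
    have lm : linear (fun z => z ** (\1 \ot a : Bs)) := lin_amull _.
    transitivity (G c ** (\1 \ot a : Bs)).
      rewrite [in RHS](coord_vbasis (memvf c)) (lin_sum _ _ _ lG) (lin_sum _ _ _ lm).
      by apply: eq_bigr => j _; rewrite (linZ lG) (linZ lm) dual_coordE.
    rewrite (lin_tliftC _ _ lm); apply: eq_tlift => x y.
    by rewrite -amulA smash_otM1.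
  have tC (X' : lmodType k) (f : X' -> H) : linear f -> linear (fun x => t (f x)).
    by move=> lf; apply: (lin_comp tlin).
  rewrite -(swA (F := fun a c1 c2 => t c2 ** (\1 \ot (antipode_inv c1 * a) : Bs))); last first.
    by split=> *; [lin|lin|apply: lin_amul_l].
  rewrite -[RHS](sw_counitl (f := t)) //.
  apply: eq_tlift => x y.
  have lg : linear (fun z : H => t y ** (\1 \ot z : Bs)) by lin.
  by rewrite -(lin_tliftC _ _ lg) antipode_invl (linZ lg) -[X in t y ** X]/(\1 : Bs) amulr1.
apply: rendoP.
apply: (tens_ext (f := Phi _) (g := T)).
- exact: (@rendo_lin _ _ (@tens_rmod k B H) (Phi _)).
- exact: (@rendo_lin _ _ (@tens_rmod k B H) T).
move=> c l.
have -> : c \ot l = ract (\1 \ot l : @tens_rmod k B H) c.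
  by rewrite [RHS]tens_ract_ot amul1r.
by rewrite !rendoB E.
Qed.

End BMIso.

Lemma inj_surj_bijective (T U : Type) (f : T -> U) :
  injective f -> (forall y, exists x, f x = y) -> bijective f.
Proof.
move=> fI /choice[g fK]; exists g => // x.
by apply: fI; rewrite fK.
Qed.

(** * Corner algebras and endomorphisms of the image of an idempotent *)

Section Corner.
Context {k : fieldType} {B : kalgType k} {M : rmod B} {S C : kalgType k}.
Variables (Phi : {linear S -> rendo M}) (iota : {linear C -> S}).
Hypothesis PhiM : {morph Phi : x y / x ** y}.
Hypothesis Phi_inj : injective Phi.
Hypothesis Phi_surj : forall T, exists z, Phi z = T.
Hypothesis iotaM : {morph iota : x y / x ** y}.
Hypothesis iota_inj : injective iota.
Hypothesis iota_corner : forall z, exists c, iota c = iota \1 ** z ** iota \1.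
Local Notation e := (iota \1).
Local Notation N := (rimage (Phi e)).

Lemma corner_image c x : Phi (iota c) x \in rimage_pred (Phi e).
Proof.
apply/asboolP; exists (Phi (iota c) x).
by rewrite -[RHS]/((Phi e ** Phi (iota c)) x) -PhiM -iotaM amul1r.
Qed.

Definition corner_fun c (x : N) : N := RImage (corner_image c (rimage_val x)).

Lemma corner_fun_rendo c : corner_fun c \in rendo_pred (M := N).
Proof.
apply/asboolP; split=> [x y|x a]; apply: val_inj.
  rewrite [RHS](linD (@rimage_val_lin _ _ _ _)).
  rewrite -[LHS]/(Phi (iota c) (rimage_val (x + y))) (linD (@rimage_val_lin _ _ _ _)).
  by rewrite (linD (rendo_lin _)).
exact: rendoB.
Qed.

Definition corner_rendo c : rendo N := REndo (corner_fun_rendo c).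

Lemma corner_rendo_lin : linear corner_rendo.
Proof.
move=> a c c'; apply: rendoP => x; apply: val_inj.
rewrite [RHS]rimage_val_lin /= linearP linearP.
by [].
Qed.

Lemma corner_id (x : N) : Phi e (rimage_val x) = rimage_val x.
Proof.
have /asboolP[y ->] := valP x.
by rewrite -[LHS]/((Phi e ** Phi e) y) -PhiM -iotaM amul1r.
Qed.

(** For an idempotent e, End(eM) is e End(M) e: an element of the corner restricts to eM, and
    conversely an endomorphism of eM is extended to M by precomposing with e. *)
Lemma corner_isomorphic : alg_isomorphic C (rendo N).
Proof.
exists (mklin corner_rendo_lin); split.
- by apply: rendoP => x; apply: val_inj; apply: corner_id.
- move=> c c'; apply: rendoP => x; apply: val_inj => /=.
  by rewrite iotaM PhiM.
apply: inj_surj_bijective => [c c' E|T].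
  apply: iota_inj; apply: Phi_inj; apply: rendoP => x.
  (* Since c = c 1, the map Phi(iota c) factors through Phi(e), so its restriction to the image
     determines it. *)
  have xP : Phi e x \in rimage_pred (Phi e) by apply/asboolP; exists x.
  have := congr1 (fun F : rendo N => rimage_val (F (RImage xP))) E.
  rewrite /= -[LHS]/((Phi _ ** Phi _) x) -[RHS]/((Phi _ ** Phi _) x).
  by rewrite -!PhiM -!iotaM !amulr1.
have eP x : Phi e x \in rimage_pred (Phi e) by apply/asboolP; exists x.
pose T' x := rimage_val (T (RImage (eP x))).
have T'P : T' \in rendo_pred (M := M).
  apply/asboolP; split=> [x y|x a].
    rewrite /T' -(linD (@rimage_val_lin _ _ _ _)) -(linD (rendo_lin T)).
    congr (rimage_val (T _)); apply: val_inj.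
    by rewrite [RHS](linD (@rimage_val_lin _ _ _ _)) /= (linD (rendo_lin _)).
  rewrite /T' -[RHS]/(rimage_val (ract (T (RImage (eP x)) : N) a)) -rendoB.
  by congr (rimage_val (T _)); apply: val_inj; rewrite /= rendoB.
(* A preimage [z] of the extension is cut down to e z e, which lies in the image of [iota] and still
   acts as [T] on eM, where Phi(e) is the identity. *)
have [z zT] := Phi_surj (REndo T'P).
have [c cE] := iota_corner z.
exists c; apply: rendoP => x; apply: val_inj.
rewrite /= cE !PhiM zT -[LHS]/(Phi e (T' (Phi e (rimage_val x)))) corner_id.
rewrite /T' corner_id; congr (rimage_val (T _)).
by apply: val_inj; rewrite /= corner_id.
Qed.

End Corner.

(** * Tensoring a linear map with an identity *)

Section TensMap.
Context {k : fieldType} {U U' : lmodType k} {V : vectType k}.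
Variable g : {linear U -> U'}.

(** The map g tensor id, written on coefficients so that injectivity and surjectivity pass from [g]
    coefficient by coefficient. *)
Definition tensmap (t : tens U V) : tens U' V := [ffun i => g (t i)].

Lemma tensmap_ot u v : tensmap (u \ot v) = g u \ot v.
Proof. by apply/ffunP => i; rewrite !ffunE linearZ. Qed.
Lemma tensmap_lin : linear tensmap.
Proof. by move=> a x y; apply/ffunP => i; rewrite !ffunE linearP. Qed.
Lemma tensmap_inj : injective g -> injective tensmap.
Proof.
by move=> gI x y /ffunP E; apply/ffunP => i; apply: gI; have := E i; rewrite !ffunE.
Qed.
Lemma tensmap_surj (t : tens U' V) :
  (forall i, exists u, g u = t i) -> exists s, tensmap s = t.
Proof.
by move=> /choice[s sE]; exists [ffun i => s i]; apply/ffunP => i; rewrite !ffunE.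
Qed.

End TensMap.

(** * The partial smash product as a corner of the global one *)

Section Envelope.
Context {k : fieldType} {H : hopfType k} {A B : kalgType k}.
Variables (p : partial_module_algebra H A) (b : module_algebra H B).
Variable phi : {linear A -> B}.
Hypothesis hphi : enveloping p b phi.
Local Notation Bs := (smash b).
Local Notation E := (phi \1 \ot 1 : Bs).

Definition envmap : tens A H -> Bs := tensmap phi.

Lemma envmap_lin : linear envmap.
Proof. exact: tensmap_lin. Qed.

(** The partial action is the global one multiplied on the left by phi(1), and this factor is
    absorbed because phi(a) phi(1) = phi(a). *)
Lemma envmapM x y : envmap (smash_mul p x y) = envmap x ** envmap y.
Proof.
have le := envmap_lin.
apply: (tens_ext (f := fun x => envmap (smash_mul p x y)) (g := fun x => envmap x ** envmap y)).
- exact: lin_comp le (lin_smash_mull p y).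
- by apply: lin_amul_l.
move=> a h.
apply: (tens_ext (f := fun y => envmap (smash_mul p (a \ot h) y))
  (g := fun y => envmap (a \ot h) ** envmap y)).
- exact: lin_comp le (lin_smash_mulr p _).
- by apply: lin_amul_r.
move=> c g; rewrite smash_mul_ot (lin_tliftC _ _ le) /envmap !tensmap_ot smash_otM.
apply: eq_tlift => u v; rewrite tensmap_ot (enveloping_mul hphi).
by rewrite (enveloping_act hphi) amulA -(enveloping_mul hphi) amulr1.
Qed.

Lemma envmap_dact f x : envmap (smash_dact f x) = smash_dual b f (envmap x).
Proof.
have le := envmap_lin.
apply: (tens_ext (f := fun x => envmap (smash_dact f x))
  (g := fun x => smash_dual b f (envmap x))).
- exact: lin_comp le (lin_smash_dact f).
- by apply: lin_mact_r.
move=> a h; rewrite smash_dact_ot (lin_tliftC _ _ le) /envmap tensmap_ot.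
by rewrite [RHS]smash_dact_ot; apply: eq_tlift => u v; rewrite tensmap_ot.
Qed.

Definition penvmap (x : psmash p) : Bs := envmap (psmash_val x).

Lemma penvmap_lin : linear penvmap.
Proof. exact: lin_comp envmap_lin (@psmash_val_lin _ _ _ p). Qed.

Definition envdual : smash (psmash_dual p) -> smash (smash_dual b) :=
  tensmap (mklin penvmap_lin).

Lemma envdual_lin : linear envdual.
Proof. exact: tensmap_lin. Qed.

Lemma penvmap1 : penvmap \1 = E.
Proof. exact: tensmap_ot. Qed.

Lemma envdual1 : envdual \1 = E \ot 1.
Proof. by rewrite [LHS]tensmap_ot [X in X \ot _]penvmap1. Qed.

Lemma penvmap_inj : injective penvmap.
Proof.
by move=> x y /(tensmap_inj (enveloping_inj hphi)) xy; apply: val_inj.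
Qed.

Lemma envdual_inj : injective envdual.
Proof. exact: (@tensmap_inj _ _ _ _ (mklin penvmap_lin) penvmap_inj). Qed.

Lemma envdualM : {morph envdual : x y / x ** y}.
Proof.
move=> x y; have le := envdual_lin.
apply: (tens_ext (f := fun x : smash (psmash_dual p) => envdual (x ** y))
  (g := fun x => envdual x ** envdual y)).
- exact: lin_comp le (@lin_amull _ (smash (psmash_dual p)) y).
- exact: lin_comp (@lin_amull _ (smash (smash_dual b)) _) le.
move=> a f.
apply: (tens_ext (f := fun y : smash (psmash_dual p) =>
    envdual ((a \ot f : smash (psmash_dual p)) ** y))
  (g := fun y => envdual (a \ot f) ** envdual y)).
- exact: lin_comp le (@lin_amulr _ (smash (psmash_dual p)) _).
- exact: lin_comp (@lin_amulr _ (smash (smash_dual b)) _) le.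
move=> c g; rewrite smash_otM (lin_tliftC _ _ le) /envdual !tensmap_ot smash_otM.
apply: eq_tlift => u v; rewrite tensmap_ot; congr (_ \ot _).
by rewrite /= /penvmap /= envmapM envmap_dact.
Qed.

(** The coefficients of E w lie in phi(1) B, hence in phi(A) by the right ideal property.
    Multiplying the preimage by 1 # 1 on the right, which corresponds to the right factor E, lands
    in the partial smash product. *)
Lemma penvmap_corner w : exists x, penvmap x = E ** w ** E.
Proof.
have [y yE] : exists y, envmap y = E ** w.
  have -> : E ** w = [ffun i => phi \1 ** w i].
    apply: (tens_ext (f := fun w : Bs => E ** w)
      (g := fun w : tens B H => [ffun i => phi \1 ** w i] : tens B H)).
    - exact: (@lin_amulr _ Bs).
    - by move=> a u v; apply/ffunP => i; rewrite !ffunE lin_amulr.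
    move=> c h; rewrite smash_ot1M; apply/ffunP => i.
    by rewrite !ffunE (linZ (lin_amulr _)).
  apply: tensmap_surj => i; rewrite ffunE.
  by have [a ->] := enveloping_ideal hphi \1 (w i); exists a.
have xP : smash_mul p y (\1 \ot 1) \in psmash_pred p by apply/psmash_predP; exists y.
exists (PSmash xP); rewrite /penvmap /= envmapM yE.
by congr (_ ** _); apply: tensmap_ot.
Qed.

(** The dual acts on E through its counit, so multiplying by the idempotent on both sides amounts to
    replacing each coefficient w of [z] by E w E; [penvmap_corner] then applies to each
    coefficient. *)
Lemma envdual_corner z : exists c, envdual c = envdual \1 ** z ** envdual \1.
Proof.
have -> : envdual \1 ** z ** envdual \1 = [ffun i => E ** z i ** E].
  rewrite envdual1.
  have lm := lin_comp (@lin_amull _ (smash (smash_dual b)) (E \ot 1))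
    (@lin_amulr _ (smash (smash_dual b)) (E \ot 1)).
  apply: (tens_ext lm (g := fun z : tens Bs (dual H) =>
    [ffun i => E ** z i ** E] : tens Bs (dual H))).
    move=> a u v; apply/ffunP => i; rewrite !ffunE.
    by rewrite (lin_amulr (E : Bs)) (lin_amull (E : Bs)).
  move=> w f; rewrite smash_ot1M smash_otM.
  transitivity ((E ** w ** E) \ot f : tens Bs (dual H)); last first.
    apply/ffunP => i; rewrite !ffunE.
    by rewrite (linZ (@lin_amulr _ Bs E)) (linZ (@lin_amull _ Bs E)).
  rewrite -[RHS](sw_counitl (f := fun f => (E ** w ** E) \ot f)); last by lin.
  apply: eq_tlift => f1 f2; rewrite mulr1 smash_dual_ot1 (linZ (lin_amulr _)).
  by rewrite (linZ ((bilin_ptens _ _).1 _)).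
apply: tensmap_surj => i; rewrite ffunE; exact: penvmap_corner.
Qed.

End Envelope.

Theorem theorem6 (k : fieldType) (H : hopfType k) (A B : kalgType k)
    (p : partial_module_algebra H A) (b : module_algebra H B)
    (phi : {linear A -> B}) (hphi : enveloping p b phi)
    (X : (\dim {:H}).-tuple H) (hX : basis_of {:H} X) :
  let e : smash (smash_dual b) := (phi \1 \ot 1 : smash b) \ot dual_one H in
  alg_isomorphic (smash (psmash_dual p)) (rendo (rimage (bm_Phi X e))).
Proof.
move=> e.
have := corner_isomorphic (Phi := mklin (@bm_Phi_lin _ _ _ b X)) 
  (iota := mklin (@envdual_lin _ _ _ _ p b phi))
  (bm_PhiM (b:=b) hX) (bm_Phi_inj hX) (bm_Phi_surj b hX) (envdualM hphi) (envdual_inj hphi)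
  (envdual_corner hphi).
by rewrite /= envdual1.
Qed.
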